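(* Let $\mathbb{V}$ be a real Hilbert space of functions on $\Omega\subset\mathbb{R}^d$ and let $b\in\mathcal{L}(\mathbb{V}\times\mathbb{V};\mathbb{R})$ be a continuous bilinear form such that, for some constant $\beta>0$, $$\sup_{v\in\mathbb{V}}\frac{b(w,v)}{\|v\|_{\mathbb{V}}}\ge\beta\|w\|_{\mathbb{V}}\ \ \forall w\in\mathbb{V},\qquad\{v\in\mathbb{V}:b(w,v)=0\ \forall w\in\mathbb{V}\}=\{0\}.$$ Consider a conforming discrete (finite-dimensional) subspace $\mathbb{V}_h\subset\mathbb{V}$ and let $K:=\{v\in\mathbb{V}:b(v_h,v)=0\ \forall v_h\in\mathbb{V}_h\}$. Let $\varpi:L^2(\Omega)\to\mathbb{W}_+$ (with $\mathbb{W}_+$ as in the context) be a weight function such that $$|b(\varpi(\xi)v,v)|\ge\alpha_h(\xi)\|v\|_{\mathbb{V}}^2\qquad\forall v\in K,$$ for some positive function $\alpha_h(\cdot)>0$ of $\xi\in L^2(\Omega)$, and let $\omega(\xi):=1/\varpi(\xi)$. For $f\in\mathbb{V}^*$ and $\xi\in L^2(\Omega)$ consider the weighted Galerkin problem (G) find $u_h\equiv S_h(\xi)\in\mathbb{V}_h$: $\ b(u_h,\omega(\xi)v_h)=f(\omega(\xi)v_h)\ \ \forall v_h\in\mathbb{V}_h$, and the equivalent mixed problem (M) find $(r,u_h)\in\mathbb{V}\times\mathbb{V}_h$: $\ b(\varpi(\xi)v,r)+b(u_h,v)=f(v)\ \forall v\in\mathbb{V}$, $\ b(v_h,r)=0\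 \forall v_h\in\mathbb{V}_h$. Then the following statements hold true: (i) For any $f\in\mathbb{V}^*$ and $\xi\in L^2(\Omega)$, problems (G) and (M) are well-posed. (ii) If there exist uniform constants $\alpha>0$ and $\varpi_\infty>0$ such that $\alpha_h(\xi)\ge\alpha$ and $\|\varpi(\xi)\|_{\mathbb{W}}\le\varpi_\infty$ for all $\xi\in L^2(\Omega)$, then the solution $u_h\equiv S_h(\cdot)$ to problems (G) and (M) is uniformly bounded on $\mathbb{X}=L^2(\Omega)$. (iii) Additionally, if $\varpi(\cdot)$ is differentiable, then $S_h(\cdot)$ is also differentiable. Moreover, if $\varpi'(\cdot)$ is uniformly bounded and Lipschitz continuous, then also $S_h'(\cdot)$ is uniformly bounded and Lipschitz continuous.
   Context: $\mathbb{W}\equiv\mathbb{W}(\Omega)$ is a Banach space of measurable functions on $\Omega$ such that for every $\mathrm{w}\in\mathbb{W}$ the multiplication operator $M_{\mathrm{w}}:\mathbb{V}\to\mathbb{V}$, $M_{\mathrm{w}}v:=\mathrm{w}v$, is a well-defined linear and continuous map (example: $\mathbb{V}=H^1(\Omega)$, $\mathbb{W}=W^{1,\infty}(\Omega)$). Define $$\mathbb{W}_+:=\{\mathrm{w}\in\mathbb{W}:\ \exists\,\mathrm{w}_{\min}>0\text{ for which }\mathrm{w}_{\min}\le\mathrm{w}(x)\le 1/\mathrm{w}_{\min}\ \forall x\in\Omega\}.$$ In this setting, $1/\mathrm{w}\in\mathbb{W}_+$ if and only if $\mathrm{w}\in\mathbb{W}_+$; in particular $\omega(\xi)=1/\varpi(\xi)\in\mathbb{W}_+$.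 Well-posed means there is a unique solution for every $f\in\mathbb{V}^*$, depending continuously on $f$. Differentiability is in the Gâteaux sense: a map $G$ from $L^2(\Omega)$ to a Banach space is differentiable at $\xi$ if for every $\eta$ the limit $G'(\xi)\eta=\lim_{t\to0}(G(\xi+t\eta)-G(\xi))/t$ exists and $\eta\mapsto G'(\xi)\eta$ is linear and continuous; $\varpi$ is regarded as a map into $\mathbb{W}$, so $\varpi'(\xi)\in\mathcal{L}(L^2(\Omega),\mathbb{W})$, and $S_h'(\xi)\in\mathcal{L}(L^2(\Omega),\mathbb{V}_h)$. Boundedness and Lipschitz continuity of derivatives refer to these operator norms. Suprema of quotients are over nonzero elements.
   Formalization: ''Space of functions'' for V and W is taken to mean that functions equal almost everywhere are identified and that norm convergence implies almost everywhere convergence of a subsequence; with no such link between norm and functions, (ii) fails. *)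

(* Defs.v *)
From HB Require Import structures.
From mathcomp Require Import all_boot all_order all_algebra ring_quotient.
From mathcomp Require Import all_classical all_reals all_analysis measurable_realfun.

Set Implicit Arguments.
Unset Strict Implicit.
Unset Printing Implicit Defensive.

Import Order.TTheory GRing.Theory Num.Theory.
Import numFieldNormedType.Exports.

Local Open Scope classical_set_scope.
Local Open Scope ring_scope.

Section LebesgueMeasure.
Variable R : realType.
Local Notation B := (measurableTypeR R).

Definition consR (n : nat) (p : B * n.-tuple B) : n.+1.-tuple B :=
  [the n.+1.-tuple B of p.1 :: p.2].

Lemma measurable_consR n : measurable_fun setT (@consR n).
Proof. exact: measurable_cons. Qed.

Section step.
Variables (n : nat) (m : {sigma_finite_measure set (n.-tuple B) -> \bar R}).

Definition lebesgue_Rn_step : set (n.+1.-tuple B) -> \bar R :=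
  pushforward (lebesgue_measure \x m)%E (@consR n).

Let lebesgue_Rn_step0 : lebesgue_Rn_step set0 = 0%E.
Proof. by rewrite /lebesgue_Rn_step /pushforward preimage_set0 measure0. Qed.

Let lebesgue_Rn_step_ge0 A : (0 <= lebesgue_Rn_step A)%E.
Proof. exact: (measure_ge0 (lebesgue_measure \x m)%E). Qed.

Let lebesgue_Rn_step_sigma_additive : semi_sigma_additive lebesgue_Rn_step.
Proof.
move=> F mF tF mUF; rewrite /lebesgue_Rn_step /pushforward preimage_bigcup.
apply: measure_semi_sigma_additive.
- by move=> k; rewrite -[X in measurable X]setTI; exact: measurable_consR.
- apply/trivIsetP => /= i j _ _ ij; rewrite -preimage_setI.
  by move/trivIsetP : tF => /(_ _ _ _ _ ij) ->//; rewrite preimage_set0.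
- rewrite -preimage_bigcup -[X in measurable X]setTI.
  exact: measurable_consR.
Qed.

HB.instance Definition _ := isMeasure.Build _ _ _ lebesgue_Rn_step
  lebesgue_Rn_step0 lebesgue_Rn_step_ge0 lebesgue_Rn_step_sigma_additive.

Lemma lebesgue_Rn_step_sigma_finite : sigma_finite setT lebesgue_Rn_step.
Proof.
have /sigma_finiteP[F [TF ndF Foo]] := sigma_finiteT (@lebesgue_measure R).
have /sigma_finiteP[G [TG ndG Goo]] := sigma_finiteT m.
pose u (t : n.+1.-tuple B) : B * n.-tuple B := (thead t, [tuple of behead t]).
have mu : measurable_fun setT u.
  apply/measurable_fun_pairP; split; first exact: measurable_tnth.
  exact: measurable_behead.
have uK p : u (consR p) = p.
  by case: p => x t; rewrite /u theadE; congr pair; exact: val_inj.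
exists (fun k => u @^-1` (F k `*` G k)).
  rewrite -preimage_bigcup -(preimage_setT u); congr (u @^-1` _).
  rewrite -setXTT TF TG predeqE => -[x y]; split.
    move=> [/= [i _ Fix] [j _ Gjy]]; exists (maxn i j) => //; split.
    - by move: x Fix; exact/subsetPset/ndF/leq_maxl.
    - by move: y Gjy; exact/subsetPset/ndG/leq_maxr.
  by move=> [i _ []/= ? ?]; split; exists i.
move=> k; have [mF Fy] := Foo k; have [mG Gy] := Goo k; split.
  by rewrite -[X in measurable X]setTI; apply: mu => //; exact: measurableX.
rewrite /lebesgue_Rn_step /pushforward -comp_preimage.
rewrite (_ : u \o _ = id); last by apply/funext => p /=; rewrite uK.
by rewrite preimage_id product_measure1E// lte_mul_pinfty// ge0_fin_numE.
Qed.

HB.instance Definition _ :=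
  Measure_isSigmaFinite.Build _ _ _ lebesgue_Rn_step lebesgue_Rn_step_sigma_finite.
End step.

(* d-dimensional Lebesgue measure on the Borel sets, as an iterated product;
   it is characterized by lebesgue_Rn_box *)
Fixpoint lebesgue_Rn (n : nat) : {sigma_finite_measure set (n.-tuple B) -> \bar R} :=
  match n with
  | 0 => [the {sigma_finite_measure set _ -> \bar R} of
            \d_([tuple] : 0.-tuple B)]
  | n'.+1 => [the {sigma_finite_measure set _ -> \bar R} of
            lebesgue_Rn_step (lebesgue_Rn n')]
  end.

Lemma lebesgue_Rn_box n (A : 'I_n -> set B) : (forall i, measurable (A i)) ->
  lebesgue_Rn n [set t | forall i, A i (tnth t i)] =
  (\prod_(i < n) lebesgue_measure (A i))%E.
Proof.
elim: n A => [|n IH] A mA.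
  by rewrite big_ord0 /= diracE mem_set// => -[].
have mbox :
    measurable [set t : n.-tuple B | forall i, A (lift ord0 i) (tnth t i)].
  rewrite (_ : [set t | _] = \bigcap_(i in [set: 'I_n])
      ((fun t : n.-tuple B => tnth t i) @^-1` A (lift ord0 i))).
    apply: fin_bigcap_measurable => // i _.
    by rewrite -[X in measurable X]setTI; exact: measurable_tnth.
  by apply/seteqP; split => t /= h i => [_|]; exact: h.
rewrite big_ord_recl -IH // -product_measure1E//=.
rewrite /lebesgue_Rn_step /pushforward; congr ((_ \x _)%E _).
apply/seteqP; split => -[x t] /=.
  move=> h; split; first exact: (h ord0).
  by move=> i; have := h (lift ord0 i); rewrite tnthS.
move=> [Ax At] i; have [j ->|->//] := unliftP ord0 i.
by rewrite tnthS.
Qed.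

End LebesgueMeasure.

(* The library's LspaceType has no linear structure: the normed space L^2(mu) is
   built as the quotient of LfunType mu (p = 2) by the mu-null functions. For mu
   the restriction of a measure to Omega, this is L^2(Omega). *)
Section L2Space.
Context d (T : measurableType d) (R : realType).
Variables (mu : {measure set T -> \bar R}).
Local Notation L := (LfunType mu (lee1n 2)).

Definition ae_null : {pred L} := fun f => `[< (f : T -> R) = cst 0 %[ae mu] >].

Lemma ae_null_zmod_closed : zmod_closed ae_null.
Proof.
split; first by apply/asboolP; exact: nearW.
move=> f g /asboolP f0 /asboolP g0; apply/asboolP.
apply: filterS2 f0 g0 => x /= /(_ I) fx /(_ I) gx _.
by rewrite -[LHS]/(f x - g x) fx gx subr0.
Qed.

HB.instance Definition _ :=
  GRing.isZmodClosed.Build L ae_null ae_null_zmod_closed.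

Lemma ae_nullZ (a : R) (f : L) : f \in ae_null -> a *: f \in ae_null.
Proof.
move=> /asboolP f0; apply/asboolP.
apply: filterS f0 => x /= /(_ I) fx _.
by rewrite -[LHS]/(a *: f x) fx scaler0.
Qed.

Definition L2 : Type := {ideal_quot ae_null}.

HB.instance Definition _ := Choice.on L2.
HB.instance Definition _ := GRing.Zmodule.on L2.

Local Open Scope quotient_scope.

Definition L2_class (f : L) : L2 := \pi_({ideal_quot ae_null}) f.
Definition L2_fun (x : L2) : L := repr (x : {ideal_quot ae_null}).

Lemma L2_funK x : L2_class (L2_fun x) = x.
Proof. exact: reprK. Qed.

Lemma L2_classD f g : L2_class (f + g) = L2_class f + L2_class g.
Proof. exact: (raddfD \pi_({ideal_quot ae_null})). Qed.

Lemma L2_class_eq f g : f - g \in ae_null -> L2_class f = L2_class g.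
Proof.
move=> fg; apply/eqP.
by rewrite -[_ == _]/(_ == _ %[mod {ideal_quot ae_null}]) -Quotient.idealrBE.
Qed.

Lemma L2_fun_class f : L2_fun (L2_class f) - f \in ae_null.
Proof. by rewrite Quotient.idealrBE; apply/eqP; exact: L2_funK. Qed.

Definition L2_scale (a : R) (x : L2) : L2 := L2_class (a *: L2_fun x).

Lemma L2_class_scale a f : L2_scale a (L2_class f) = L2_class (a *: f).
Proof.
by apply: L2_class_eq; rewrite -scalerBr; exact/ae_nullZ/L2_fun_class.
Qed.

Let L2_scaleA a b x : L2_scale a (L2_scale b x) = L2_scale (a * b) x.
Proof. by rewrite -[x]L2_funK !L2_class_scale scalerA. Qed.

Let L2_scale1 : left_id 1 L2_scale.
Proof. by move=> x; rewrite -[x]L2_funK L2_class_scale scale1r. Qed.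

Let L2_scaleDr : right_distributive L2_scale +%R.
Proof.
move=> a x y; rewrite -[x]L2_funK -[y]L2_funK.
by rewrite -L2_classD !L2_class_scale scalerDr L2_classD.
Qed.

Let L2_scaleDl x : {morph L2_scale^~ x : a b / a + b}.
Proof.
by move=> a b; rewrite -[x]L2_funK !L2_class_scale scalerDl L2_classD.
Qed.

HB.instance Definition _ := GRing.Zmodule_isLmodule.Build R L2
  L2_scaleA L2_scale1 L2_scaleDr L2_scaleDl.

Let nrm (f : L) : R := fine ('N[mu]_2%:R%:E[EFin \o f])%E.

Let nrm_null f : f \in ae_null -> nrm f = 0.
Proof.
move=> /asboolP f0; rewrite /nrm unlock /Lnorm.
rewrite (ae_eq_integral (cst 0%E)) //.
- by rewrite integral0 poweR0r// invr_eq0 pnatr_eq0.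
- apply: (@measurableT_comp _ _ _ _ _ _ (fun x : \bar R => x `^ 2)%E) => //=.
    exact: (measurableT_comp (measurable_poweR _)).
  by apply/measurable_EFinP; exact: measurableT_comp.
- apply: filterS f0 => x /= /(_ I) fx _.
  by rewrite /= fx normr0 powR0 ?pnatr_eq0.
Qed.

Let nrm_le f g : f - g \in ae_null -> nrm f <= nrm g.
Proof.
move=> /nrm_null fg0; rewrite -[f](subrK g) (le_trans (ler_LnormD _ _))//.
by rewrite gerDr -[fine _]/(nrm (f - g)) fg0.
Qed.

Definition L2_norm (x : L2) : R := nrm (L2_fun x).

Lemma L2_norm_class f : L2_norm (L2_class f) = nrm f.
Proof.
apply/le_anti/andP; split; apply: nrm_le; first exact: L2_fun_class.
by rewrite -opprB rpredN; exact: L2_fun_class.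
Qed.

Let L2_normD x y : L2_norm (x + y) <= L2_norm x + L2_norm y.
Proof.
by rewrite -[x]L2_funK -[y]L2_funK -L2_classD !L2_norm_class ler_LnormD.
Qed.

Let L2_normZ a x : L2_norm (a *: x) = `|a| * L2_norm x.
Proof.
rewrite -[x]L2_funK -[a *: _]/(L2_scale a _) L2_class_scale !L2_norm_class.
by apply/EFin_inj; rewrite EFinM !finite_norm_fine -LnormZ.
Qed.

Let L2_norm0_eq0 x : L2_norm x = 0 -> x = 0.
Proof.
rewrite -[x]L2_funK L2_norm_class => /fine_Lnormr_eq0 f0.
rewrite -[0](raddf0 \pi_({ideal_quot ae_null})); apply: L2_class_eq.
by rewrite subr0; apply/asboolP.
Qed.

HB.instance Definition _ := Lmodule_isNormed.Build R L2
  L2_normD L2_normZ L2_norm0_eq0.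

End L2Space.

Section FunctionSpaces.
Context d (T : measurableType d) (R : realType).
Variable mu : {measure set T -> \bar R}.

(* E is a normed space of measurable functions, where fn u is a representative
   of u and functions are identified when equal almost everywhere. The last
   clause relates the norm to the functions: norm convergence implies almost
   everywhere convergence of a subsequence (i.e., E embeds continuously in the
   space of measurable functions). *)
Definition function_space (E : normedModType R) (fn : E -> {mfun T >-> R}) :=
  [/\ forall (a : R) u v,
        (fn (a *: u + v) : T -> R) = (fun x => a * fn u x + fn v x) %[ae mu],
      forall u, (fn u : T -> R) = cst 0 %[ae mu] -> u = 0 &
      forall (u_ : nat -> E) (u : E), u_ @ \oo --> u ->
        exists2 phi : nat -> nat, {homo phi : m n / (m < n)%N} &
          {ae mu, forall x, (fun n => fn (u_ (phi n)) x) @ \oo --> fn u x}].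

Definition multiplication (W V : normedModType R)
    (fnW : W -> {mfun T >-> R}) (fnV : V -> {mfun T >-> R}) (M : W -> V -> V) :=
  forall w, [/\ forall v,
                  (fnV (M w v) : T -> R) = (fun x => fnW w x * fnV v x) %[ae mu],
                linear (M w) & continuous (M w)].

Definition Wplus (W : normedModType R) (fnW : W -> {mfun T >-> R}) : set W :=
  [set w | exists2 c : R, 0 < c & {ae mu, forall x, c <= fnW w x <= c^-1}].

Definition is_reciprocal (W : normedModType R) (fnW : W -> {mfun T >-> R})
    (w w' : W) := (fnW w' : T -> R) = (fun x => (fnW w x)^-1) %[ae mu].

(* 1/w as an element of W; junk value 0 if the function 1/w is not in W *)
Definition recip (W : normedModType R) (fnW : W -> {mfun T >-> R}) (w : W) : W :=
  xget 0 [set w' | is_reciprocal fnW w w'].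

End FunctionSpaces.

Section NormedSpaces.
Variable R : realType.

(* the operator norm of T, when T is linear and continuous *)
Definition opnorm (U W : normedModType R) (T : U -> W) : R :=
  sup [set `|T u| / `|u| | u in [set u | u != 0]].

Definition fin_dim_subspace (V : normedModType R) (A : set V) :=
  exists (n : nat) (e : 'I_n -> V),
    A = [set v | exists a : 'I_n -> R, v = \sum_(i < n) a i *: e i].

(* P f z means that z solves the problem with datum f in the dual of V *)
Definition well_posed (V Z : normedModType R)
    (P : {linear V -> R} -> Z -> Prop) :=
  (forall f : {linear V -> R}, continuous f -> exists! z, P f z) /\
  (forall (f : {linear V -> R}) (z : Z), continuous f -> P f z ->
    forall e : R, 0 < e -> exists2 delta : R, 0 < delta &
      forall (g : {linear V -> R}) (z' : Z), continuous g -> P g z' ->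
        opnorm (g \- f) < delta -> `|z' - z| < e).

Definition gateaux (X Y : normedModType R) (G : X -> Y) :=
  forall xi, [/\ forall eta, derivable G xi eta,
                 linear (fun eta => 'D_eta G xi) &
                 continuous (fun eta => 'D_eta G xi)].

Definition bounded_derivative (X Y : normedModType R) (G : X -> Y) :=
  exists C : R, forall xi, opnorm (fun eta => 'D_eta G xi) <= C.

Definition lipschitz_derivative (X Y : normedModType R) (G : X -> Y) :=
  exists L : R, forall xi1 xi2,
    opnorm (fun eta => 'D_eta G xi1 - 'D_eta G xi2) <= L * `|xi1 - xi2|.

End NormedSpaces.

Section Problems.
Variables (R : realType) (V : normedModType R) (b : V -> V -> R) (Vh : set V).

Definition kernel_space : set V := [set v | forall vh, Vh vh -> b vh v = 0].

(* Mw is the multiplication by the weight omega(xi) *)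
Definition galerkin (Mw : V -> V) (f : {linear V -> R}) (u : V) :=
  Vh u /\ forall vh, Vh vh -> b u (Mw vh) = f (Mw vh).

(* Mw is the multiplication by varpi(xi), the unknown is z = (r, u_h) *)
Definition mixed (Mw : V -> V) (f : {linear V -> R}) (z : V * V) :=
  [/\ Vh z.2, forall v, b (Mw v) z.1 + b z.2 v = f v &
      forall vh, Vh vh -> b vh z.1 = 0].

Definition galerkin_sol (Mw : V -> V) (f : {linear V -> R}) : V :=
  xget 0 [set u | galerkin Mw f u].

End Problems.

(* Main.v *)
(* Multiplication by varpi and by omega are mutually inverse, so (G) follows from
   (M) with the test function v = omega v_h; conversely the inf-sup condition
   makes the transposed problem b w r = g w solvable, and this yields the
   multiplier r. (G) is a square linear system with injective adjoint, whence
   existence. Testing (M) with v = r in the kernel space gives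
   |r| <= |f| / alpha, and the inf-sup condition then bounds u_h: the solution
   operator of (M) is bounded by a constant that depends only on alpha and on
   a bound of varpi. The derivative of (r, u_h) in the direction eta solves (M)
   with right-hand side v |-> - b (varpi'(xi) eta v) r, and all the estimates on
   difference quotients and on derivatives apply this bound to the system solved
   by a difference of solutions. The continuity of multiplication in the weight,
   |w v| <= C |w| |v|, is not assumed: it is a closed graph argument, the graph
   being closed because convergence in norm implies convergence almost
   everywhere of a subsequence. *)

Require Import Defs.
From HB Require Import structures.
From mathcomp Require Import all_boot all_order all_algebra.
From mathcomp Require Import all_classical all_reals all_analysis measurable_realfun.
From mathcomp Require Import ring lra.

Set Implicit Arguments.
Unset Strict Implicit.
Unset Printing Implicit Defensive.

Import Order.TTheory GRing.Theory Num.Theory.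
Import numFieldNormedType.Exports.

Local Open Scope classical_set_scope.
Local Open Scope ring_scope.

(** * Bounds and operator norms of linear and bilinear maps *)

Section BoundedOperators.
Variable R : realType.
Implicit Types U W : normedModType R.

Lemma linear_fun0 U W (f : U -> W) : linear f -> f 0 = 0.
Proof. by move=> lf; have := lf (-1) 0 0; rewrite !scaleN1r !addNr. Qed.

Lemma linear_funD U W (f : U -> W) u v : linear f -> f (u + v) = f u + f v.
Proof. by move=> lf; have := lf 1 u v; rewrite !scale1r. Qed.

Lemma linear_funZ U W (f : U -> W) a u : linear f -> f (a *: u) = a *: f u.
Proof. by move=> lf; have := lf a u 0; rewrite (linear_fun0 lf) !addr0. Qed.

Lemma linear_funN U W (f : U -> W) u : linear f -> f (- u) = - f u.
Proof. by move=> lf; rewrite -scaleN1r linear_funZ// scaleN1r. Qed.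

Lemma linear_funB U W (f : U -> W) u v : linear f -> f (u - v) = f u - f v.
Proof. by move=> lf; rewrite linear_funD// linear_funN. Qed.

Lemma linear_continuous_bound U W (f : U -> W) : linear f -> continuous f ->
  exists2 C : R, 0 <= C & forall u, `|f u| <= C * `|u|.
Proof.
move=> lf cf.
pose F : {linear U -> W} := HB.pack f (GRing.isLinear.Build _ _ _ _ f lf).
have /linear_boundedP : bounded_near F (nbhs 0).
  by apply: continuous_linear_bounded; exact: cf.
move=> [C [_ FC]]; exists (`|C| + 1); first by rewrite addr_ge0.
by apply: FC; rewrite ltr_pwDr// ler_norm.
Qed.

Lemma linear_bound_continuous U W (f : U -> W) (C : R) : linear f ->
  (forall u, `|f u| <= C * `|u|) -> continuous f.
Proof.
move=> lf fC.
pose F : {linear U -> W} := HB.pack f (GRing.isLinear.Build _ _ _ _ f lf).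
apply/(linear_bounded_continuous F)/linear_boundedP.
exists (`|C|); split => [|r Cr u]; first exact: normr_real.
by rewrite (le_trans (fC u))// ler_wpM2r// (le_trans (ler_norm C))// ltW.
Qed.

Lemma opnorm_le U W (f : U -> W) (C : R) : 0 <= C ->
  (forall u, `|f u| <= C * `|u|) -> opnorm f <= C.
Proof.
move=> C0 fC; rewrite /opnorm.
(* In the zero space there are no quotients and [sup] takes its default value 0, whence the
   assumption [0 <= C]. *)
have [->|/set0P ne] := eqVneq [set `|f u| / `|u| | u in [set u | u != 0]] set0.
  by rewrite sup0.
apply: ge_sup => // _ [u /= u0 <-].
by rewrite ler_pdivrMr ?normr_gt0.
Qed.

Lemma le_opnorm U W (f : U -> W) u : linear f -> continuous f ->
  `|f u| <= opnorm f * `|u|.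
Proof.
move=> lf cf; have [->|u0] := eqVneq u 0.
  by rewrite (linear_fun0 lf) !normr0 mulr0.
rewrite -ler_pdivrMr ?normr_gt0//; apply: ub_le_sup; last by exists u.
have [C C0 fC] := linear_continuous_bound lf cf.
by exists C => _ [v /= v0 <-]; rewrite ler_pdivrMr ?normr_gt0.
Qed.

Lemma opnorm_ge0 U W (f : U -> W) : linear f -> continuous f -> 0 <= opnorm f.
Proof.
move=> lf cf; have [[u u0]|no_u] := pselect (exists u : U, u != 0).
  rewrite -(@pmulr_lge0 _ `|u|) ?normr_gt0//.
  by rewrite (le_trans _ (le_opnorm u lf cf)).
rewrite /opnorm (_ : image _ _ = set0) ?sup0//.
by apply/seteqP; split=> // _ [u /= u0 _]; apply: no_u; exists u.
Qed.

(** Continuity at the origin gives a ball of radius [e] on which [|b| < 1]; rescaling both arguments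
    to length [e / 2] yields the constant [(2 / e) ^+ 2]. *)
Lemma bilinear_continuous_bound U (b : U -> U -> R) :
  (forall u, linear (b u)) -> (forall v, linear (b^~ v)) ->
  continuous (fun p : U * U => b p.1 p.2) ->
  exists2 C : R, 0 <= C & forall u v, `|b u v| <= C * `|u| * `|v|.
Proof.
move=> br bl cb.
have b0r u : b u 0 = 0 by exact: linear_fun0 (br u).
have b0l v : b 0 v = 0 by exact: linear_fun0 (bl v).
have bZ u v c c' : b (c *: u) (c' *: v) = c * (c' * b u v).
  by rewrite [LHS](linear_funZ _ _ (bl _)) (linear_funZ _ _ (br _)).
have : \forall p \near (0 : U * U), `|b p.1 p.2| < 1.
  have := cb (0, 0); rewrite /continuous_at /= b0r.
  by move=> /cvgr0Pnorm_lt/(_ _ ltr01).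
move=> /nbhs_ballP[e /= e0 be].
exists ((2 / e) ^+ 2) => [|u v]; first exact: sqr_ge0.
have half w : w != 0 -> ball (0 : U) e ((e / 2 / `|w|) *: w).
  move=> w0; rewrite -ball_normE /= sub0r normrN normrZ normrM normfV normr_id.
  by rewrite divfK ?normr_eq0// gtr0_norm ?divr_gt0// ltr_pdivrMr// ltr_pMr// ltr1n.
have [->|u0] := eqVneq u 0.
  by rewrite b0l normr0 mulr_ge0// mulr_ge0 ?sqr_ge0.
have [->|v0] := eqVneq v 0.
  by rewrite b0r normr0 mulr_ge0// mulr_ge0 ?sqr_ge0.
have nu : 0 < `|u| by rewrite normr_gt0.
have nv : 0 < `|v| by rewrite normr_gt0.
set cu := e / 2 / `|u|; set cv := e / 2 / `|v|.
have cu0 : 0 < cu by rewrite !divr_gt0.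
have cv0 : 0 < cv by rewrite !divr_gt0.
have : `|b (cu *: u) (cv *: v)| < 1.
  by apply: (be (_, _)); split; exact: half.
rewrite bZ => /ltW; rewrite normrM (gtr0_norm cu0) normrM (gtr0_norm cv0) mulrA => h.
rewrite -(@ler_pM2l _ (cu * cv)); last exact: mulr_gt0.
apply: (le_trans h); rewrite le_eqVlt; apply/orP; left; apply/eqP.
by rewrite /cu /cv; field; rewrite !gt_eqF.
Qed.

End BoundedOperators.

(** * Consequences of completeness: Riesz representation and closed graph *)

Lemma cauchy_rate_cvg (R : realType) (V : completeNormedModType R)
    (u : nat -> V) (e : nat -> R) : e @ \oo --> 0 ->
  (forall m n, (n <= m)%N -> `|u m - u n| <= e n) -> cvg (u @ \oo).
Proof.
move=> e0 ue; apply/cauchy_cvgP/cauchy_exP => eps eps0.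
have /cvgr0Pnorm_lt/(_ _ eps0)[N _ Ne] := e0.
exists (u N); exists N => //= n Nn; rewrite -ball_normE /= distrC.
by rewrite (le_lt_trans (ue _ _ Nn))// (le_lt_trans (ler_norm _))// Ne/=.
Qed.

(* Minimise a v v - 2 g v; minimising sequences are Cauchy by the parallelogram
   identity. *)
Lemma riesz_representation (R : realType) (V : completeNormedModType R)
    (a : V -> V -> R) (c C G : R) (g : V -> R) :
  (forall u, linear (a u)) -> (forall u v, a u v = a v u) ->
  0 < c -> (forall v, c * `|v| ^+ 2 <= a v v) ->
  (forall u v, `|a u v| <= C * `|u| * `|v|) ->
  linear g -> (forall v, `|g v| <= G * `|v|) ->
  exists z, forall w, a w z = g w.
Proof.
move=> al aC c0 ac aB lg gB.
have aDr u v w : a u (v + w) = a u v + a u w by exact: linear_funD.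
have aDl u v w : a (u + v) w = a u w + a v w by rewrite aC aDr ![a w _]aC.
have aZr k u v : a u (k *: v) = k * a u v by exact: (linear_funZ _ _ (al u)).
have aZl k u v : a (k *: u) v = k * a u v by rewrite aC aZr aC.
have gD u v : g (u + v) = g u + g v by exact: linear_funD.
have gZ k v : g (k *: v) = k * g v by exact: (linear_funZ _ _ lg).
pose J v := a v v - 2 * g v.
(* Complete the square in [c |v|^2 - 2 G |v|], which is a lower bound of [J v]. *)
have Jlb v : - (G ^+ 2 / c) <= J v.
  have := gB v; have := ac v; rewrite ler_norml /J => acv /andP[_ gv].
  have : 0 <= (c * `|v| - G) ^+ 2 / c by rewrite divr_ge0 ?sqr_ge0// ltW.
  have -> : (c * `|v| - G) ^+ 2 / c = c * `|v| ^+ 2 - 2 * (G * `|v|) + G ^+ 2 / c.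
    by field; rewrite gt_eqF.
  lra.
have Jinf : has_inf (range J).
  split; first by exists (J 0), 0.
  by exists (- (G ^+ 2 / c)) => _ [v _ <-].
pose m := inf (range J).
have mJ v : m <= J v by apply: ge_inf; [exact: Jinf.2|exists v].
pose h (n : nat) : R := n.+1%:R^-1.
have h0 n : 0 < h n by rewrite invr_gt0 ltr0n.
have hle k n : (n <= k)%N -> h k <= h n.
  by move=> nk; rewrite /h lef_pV2 ?posrE ?ltr0n// ler_nat ltnS.
have /choice[v_ v_P] (n : nat) : exists v, J v < m + h n.
  have [_ [v _ <-] vh] := inf_adherent (h0 n) Jinf.
  by exists v.
(* [a (u - v) (u - v)] equals [2 J u + 2 J v - 4 J ((u + v) / 2)], as the terms in [g] cancel, and
   [m] bounds [J] below at the midpoint. *)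
have mid u v : c * `|u - v| ^+ 2 <= 2 * (J u + J v - 2 * m).
  apply: (le_trans (ac _)).
  have := mJ (2^-1 *: (u + v)).
  rewrite -[u - v]/(u + - v) -scaleN1r /J.
  rewrite !(aDr, aDl, aZl, aZr, gZ, gD) (aC v u); lra.
have cvgh : h @ \oo --> 0 by exact: cvg_harmonic.
have cv : cvg (v_ @ \oo).
  apply: (@cauchy_rate_cvg _ _ _ (fun n => Num.sqrt (4 / c * h n))).
    rewrite -[0 in X in _ --> X]sqrtr0; apply: continuous_cvg.
      exact: sqrt_continuous.
    by rewrite -(mulr0 (4 / c)); apply: cvgMr.
  move=> k n nk.
  rewrite -[leLHS]normr_id -sqrtr_sqr; apply: ler_wsqrtr.
  rewrite -(@ler_pM2l _ c)// (le_trans (mid _ _))//.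
  have -> : c * (4 / c * h n) = 4 * h n by field; rewrite gt_eqF.
  have := v_P k; have := v_P n; have := hle _ _ nk; lra.
exists (lim (v_ @ \oo)) => w; apply/eqP; rewrite -subr_eq0; apply/eqP.
(* The summand 1 keeps [A] positive when [w = 0]. With [d] the residual [a w (v_ n) - g w],
   subtracting [d / A] times [w] from [v_ n] lowers [J] by at least [d ^+ 2 / A], which cannot
   exceed [h n]. *)
pose A := a w w + 1.
have A0 : 0 < A by rewrite ltr_pwDr// (le_trans _ (ac w))// mulr_ge0 ?sqr_ge0 ?ltW.
have dn n : (a w (v_ n) - g w) ^+ 2 <= A * h n.
  have := mJ (v_ n - ((a w (v_ n) - g w) / A) *: w); have := v_P n.
  rewrite -scaleNr /J !(aDr, aDl, aZl, aZr, gZ, gD) (aC (v_ n) w).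
  set d := a w (v_ n) - g w => v1 v2.
  have : d ^+ 2 / A <= h n.
    have AE : a w w = A - 1 by rewrite /A addrK.
    have dE : a w (v_ n) = d + g w by rewrite /d subrK.
    have : d / A * (d / A) >= 0 by rewrite -expr2 sqr_ge0.
    have : d / A * (d / A) * A = d ^+ 2 / A by field; rewrite gt_eqF.
    have : d / A * d = d ^+ 2 / A by field; rewrite gt_eqF.
    move: v1 v2; rewrite AE dE; move: (d ^+ 2 / A) (d / A) => x y; nra.
  by rewrite ler_pdivrMr// mulrC.
have awc : a w (v_ n) @[n --> \oo] --> a w (lim (v_ @ \oo)).
  apply: continuous_cvg cv.
  apply: (linear_bound_continuous (al w)) => v; exact: aB.
have d2 : (a w (v_ n) - g w) ^+ 2 @[n --> \oo] --> (a w (lim (v_ @ \oo)) - g w) ^+ 2.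
  by apply: cvgM; (apply: cvgB; [exact: awc|exact: cvg_cst]).
have d20 : (a w (v_ n) - g w) ^+ 2 @[n --> \oo] --> 0.
  apply: (@squeeze_cvgr _ _ _ _ (cst 0) (fun n => A * h n)).
  - by apply: nearW => n; rewrite sqr_ge0 dn.
  - exact: cvg_cst.
  - by rewrite -(mulr0 A); apply: cvgMr.
have : (a w (lim (v_ @ \oo)) - g w) ^+ 2 = 0.
  exact: cvg_unique _ d2 d20.
by move=> /eqP; rewrite sqrf_eq0 => /eqP.
Qed.

(* The closed graph theorem, uniformly in the second variable. By Baire, the
   closure of some {w | forall u, |M w u| <= n |u|} contains a ball; successive
   approximation then writes each w of a smaller ball as a series of such
   elements, scaled by powers of 1/2, which M maps to an absolutely convergent
   series whose sum is M w u because the graph is closed. *)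
Lemma closed_graph_bilinear_bound (R : realType) (W V : completeNormedModType R)
    (U : normedModType R) (M : W -> U -> V) :
  (forall u, linear (M^~ u)) ->
  (forall w, exists C, forall u, `|M w u| <= C * `|u|) ->
  (forall (s : nat -> W) w u y, s @ \oo --> w ->
     M (s n) u @[n --> \oo] --> y -> y = M w u) ->
  exists2 C, 0 <= C & forall w u, `|M w u| <= C * `|w| * `|u|.
Proof.
move=> Ml MB Mcl.
have MN w u : M (- w) u = - M w u by exact: (linear_funN _ (Ml u)).
have MD w w' u : M (w + w') u = M w u + M w' u by exact: (linear_funD _ _ (Ml u)).
have MZ k w u : M (k *: w) u = k *: M w u by exact: (linear_funZ _ _ (Ml u)).
have M0 u : M 0 u = 0 by exact: linear_fun0 (Ml u).
pose E (n : nat) := [set w | forall u, `|M w u| <= n%:R * `|u|].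
have [n [w0 [rho rho0 wE]]] :
    exists (n : nat) (w0 : W), exists2 rho : R, 0 < rho & ball w0 rho `<=` closure (E n).
  (* Otherwise Baire gives a point [a] outside the closure of every [E i], against the bound on
     [M a]. *)
  apply: contrapT => noball.
  have : forall i, open (~` closure (E i)) /\ dense (~` closure (E i)).
    move=> i; split; first by apply: closed_openC; exact: closed_closure.
    move=> O [x Ox] oO; apply: contrapT => OE; apply: noball; exists i, x.
    have /nbhs_ballP[r /= r0 rO] : nbhs x O by exact: open_nbhs_nbhs.
    exists r => // y /rO Oy; apply: contrapT => yE; apply: OE.
    by exists y.
  move=> Eclosed; have [|a [_ aE]] := @Baire _ W _ Eclosed setT _ openT.
    by exists 0.
  have [C MaC] := MB a.
  apply: (aE (Num.bound `|C|) I); apply: subset_closure => u.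
  rewrite (le_trans (MaC u))// ler_wpM2r// (le_trans (ler_norm C))// ltW//.
  exact: archi_boundP.
(* The factor 2 comes from moving the ball to the origin: [w] is approximated by a difference of
   elements of [E n] close to [w0 + w] and to [w0]. *)
pose N : R := 2 * n%:R.
have N0 : 0 <= N by rewrite mulr_ge0.
have approx w (eps : R) : `|w| < rho -> 0 < eps ->
    exists2 e, forall u, `|M e u| <= N * `|u| & `|w - e| < eps.
  move=> wr eps0; have e2 : 0 < eps / 2 by rewrite divr_gt0.
  have : closure (E n) (w0 + w).
    by apply: wE; rewrite -ball_normE /= opprD addrA subrr sub0r normrN.
  move=> /(_ _ (nbhsx_ballx _ _ e2))[e1 [e1E]]; rewrite -ball_normE /= => we1.
  have : closure (E n) w0 by apply: wE; exact: ballxx.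
  move=> /(_ _ (nbhsx_ballx _ _ e2))[e0 [e0E]]; rewrite -ball_normE /= => we0.
  exists (e1 - e0) => [u|].
    rewrite MD MN (le_trans (ler_normB _ _))// /N.
    by have := e1E u; have := e0E u; lra.
  have -> : w - (e1 - e0) = (w0 + w - e1) - (w0 - e0).
    by rewrite !opprB -[w0 + w - e1]addrA [e0 - w0]addrC addrACA subrr add0r
      addrA addrAC.
  by rewrite (le_lt_trans (ler_normB _ _))// (splitr eps) ltrD.
pose h (k : nat) : R := 2^-1 ^+ k.
have h0 k : 0 < h k by rewrite exprn_gt0.
have hS k : h k.+1 = h k / 2 by rewrite /h exprSr.
(* [step (k, x)] is the correction of the remainder [x] at stage [k]; remainders that are too large
   get the dummy value 0. *)
have /choice[step stepP] (kw : nat * W) : exists e, `|kw.2| < rho * h kw.1 ->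
    (forall u, `|M e u| <= N * h kw.1 * `|u|) /\ `|kw.2 - e| < rho * h kw.1.+1.
  case: kw => k w /=; have [wr|nwr] := pselect (`|w| < rho * h k); last by exists 0.
  have [||e eN we] := @approx ((h k)^-1 *: w) (rho / 2).
  - by rewrite normrZ gtr0_norm ?invr_gt0// mulrC ltr_pdivrMr.
  - by rewrite divr_gt0.
  exists (h k *: e) => _; split=> [u|].
    rewrite MZ normrZ gtr0_norm// mulrAC mulrC ler_wpM2r// ?ltW//.
  have -> : w - h k *: e = h k *: ((h k)^-1 *: w - e).
    by rewrite scalerBr scalerA divff ?gt_eqF// scale1r.
  by rewrite normrZ gtr0_norm// hS mulrCA ltr_pM2l.
have small w u : `|w| < rho -> `|M w u| <= 2 * N * `|u|.
  move=> wr.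
  (* [w_ k] is the remainder after [k] corrections, and [s k] below is the sum of these
     corrections. *)
  pose w_ := nat_rect (fun=> W) w (fun k x => x - step (k, x)).
  have w_h k : `|w_ k| < rho * h k.
    elim: k => [|k /(stepP (_, _))[_]//]; by rewrite /h expr0 mulr1.
  have stepM k : `|M (w_ k) u - M (w_ k.+1) u| <= N * h k * `|u|.
    rewrite /= MD MN opprB addrCA subrr addr0.
    by have [+ _] := stepP (_, _) (w_h k); exact.
  have h_cvg : h @ \oo --> 0.
    by apply: cvg_expr; rewrite ger0_norm// invf_lt1// ltr1n.
  have w_0 : w_ @ \oo --> 0.
    apply/norm_cvg0P; apply: (@squeeze_cvgr _ _ _ _ (cst 0) (fun k => rho * h k)).
    - by apply: nearW => k; rewrite normr_ge0 ltW.
    - exact: cvg_cst.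
    - by rewrite -(mulr0 rho); apply: cvgMr.
  pose s k := w - w_ k.
  have s_w : s @ \oo --> w.
    by rewrite -[X in _ --> X]subr0; apply: cvgB => //; exact: cvg_cst.
  (* The sum of [h j] over [k <= j < m] is [2 * (h k - h m)]; this exact form lets the induction on
     [m] close. *)
  have Ms m k : (k <= m)%N ->
      `|M (s m) u - M (s k) u| <= 2 * N * `|u| * (h k - h m).
    elim: m => [|m IH]; first by rewrite leqn0 => /eqP->; rewrite !subrr normr0 mulr0.
    rewrite leq_eqVlt => /orP[/eqP->|]; first by rewrite !subrr normr0 mulr0.
    rewrite ltnS => /IH {}IH.
    have -> : M (s m.+1) u - M (s k) u =
        (M (w_ m) u - M (w_ m.+1) u) + (M (s m) u - M (s k) u).
      rewrite [RHS]addrA; congr (_ - _).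
      by rewrite /s !(MD w) !MN [RHS]addrC addrA subrK.
    rewrite (le_trans (ler_normD _ _))// hS.
    by have := stepM m; lra.
  have Msle m k : (k <= m)%N -> `|M (s m) u - M (s k) u| <= 2 * N * `|u| * h k.
    move=> /Ms/le_trans; apply; rewrite ler_wpM2l ?mulr_ge0// gerBl.
    exact: ltW.
  have /cvg_ex[y My] : cvg (M (s k) u @[k --> \oo]).
    apply: (cauchy_rate_cvg _ Msle).
    by rewrite -(mulr0 (2 * N * `|u|)); apply: cvgMr.
  rewrite -(Mcl _ _ _ _ s_w My).
  apply: (ler_cvg_to (cvg_norm My) (cvg_cst (2 * N * `|u|))).
  apply: nearW => k; have := Msle k 0 (leq0n k).
  by rewrite /s /= subrr M0 subr0 /h expr0 mulr1.
exists (2 * N * (2 / rho)) => [|w u]; first by rewrite !mulr_ge0// invr_ge0 ltW.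
have [->|wn0] := eqVneq w 0; first by rewrite M0 !normr0 mulr0 mul0r.
have nw : 0 < `|w| by rewrite normr_gt0.
have c0 : 0 < rho / 2 / `|w| by rewrite !divr_gt0.
(* This multiple of [w] has norm [rho / 2], strictly inside the ball. *)
have := small ((rho / 2 / `|w|) *: w) u.
rewrite MZ (normrZ _ w) (normrZ _ (M w u)) (gtr0_norm c0) divfK ?gt_eqF//.
rewrite ltr_pdivrMr// ltr_pMr// ltr1n.
move=> /(_ isT); rewrite -ler_pdivlMl// => /le_trans; apply.
rewrite le_eqVlt; apply/orP; left; apply/eqP.
by field; rewrite !gt_eqF.
Qed.

(** * The mixed problem *)

Section SaddlePoint.
Variables (R : realType) (V : completeNormedModType R).
Variable ip : V -> V -> R.
Hypotheses (ipl : forall u, linear (ip u)) (ipC : forall u v, ip u v = ip v u).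
Hypothesis ip_norm : forall v, `|v| ^+ 2 = ip v v.

Lemma cauchy_schwarz u v : `|ip u v| <= `|u| * `|v|.
Proof.
have ipDr x y z : ip x (y + z) = ip x y + ip x z by exact: linear_funD.
have ipDl x y z : ip (x + y) z = ip x z + ip y z by rewrite ipC ipDr ![ip z _]ipC.
have ipZr k x y : ip x (k *: y) = k * ip x y by exact: (linear_funZ _ _ (ipl x)).
have ipZl k x y : ip (k *: x) y = k * ip x y by rewrite ipC ipZr ipC.
have [->|u0] := eqVneq u 0.
  by rewrite ipC (linear_fun0 (ipl v)) !normr0 mul0r.
have [->|v0] := eqVneq v 0.
  by rewrite (linear_fun0 (ipl u)) !normr0 mulr0.
have nu : 0 < `|u| by rewrite normr_gt0.
have nv : 0 < `|v| by rewrite normr_gt0.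
(* Expand the squared norm of [|v| u + s |u| v]; [s = 1] and [s = -1] give the two inequalities, up
   to the factor [|u| |v|]. *)
have h (s : R) : 0 <= `|v| ^+ 2 * `|u| ^+ 2 + 2 * (s * `|u|) * `|v| * ip u v
             + s ^+ 2 * `|u| ^+ 2 * `|v| ^+ 2.
  have ip0 x : 0 <= ip x x by rewrite -ip_norm sqr_ge0.
  have := ip0 ((`|v| *: u) + ((s * `|u|) *: v)).
  by rewrite !(ipDl, ipDr, ipZl, ipZr) -!ip_norm (ipC v u); lra.
have uv : 0 < `|u| * `|v| by rewrite mulr_gt0.
have := h 1; have := h (-1); rewrite ler_norml.
move: uv; set x := `|u|; set y := `|v|; set z := ip u v => uv h1 h2.
apply/andP; split; rewrite -(ler_pM2l uv); nra.
Qed.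

Variable b : V -> V -> R.
Hypotheses (br : forall u, linear (b u)) (bl : forall v, linear (b^~ v)).
Variables (Cb beta : R).
Hypotheses (Cb0 : 0 <= Cb) (b_bound : forall u v, `|b u v| <= Cb * `|u| * `|v|).
Hypothesis beta0 : 0 < beta.
Hypothesis inf_sup : forall w C, 0 <= C -> (forall v, `|b w v| <= C * `|v|) ->
  beta * `|w| <= C.

Local Lemma bDr u v w : b u (v + w) = b u v + b u w.
Proof. exact: linear_funD. Qed.
Local Lemma bDl u v w : b (u + v) w = b u w + b v w.
Proof. exact: (linear_funD _ _ (bl w)). Qed.
Local Lemma bZr k u v : b u (k *: v) = k * b u v.
Proof. exact: (linear_funZ _ _ (br u)). Qed.
Local Lemma bZl k u v : b (k *: u) v = k * b u v.
Proof. exact: (linear_funZ _ _ (bl v)). Qed.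
Local Lemma b0r u : b u 0 = 0.
Proof. exact: linear_fun0 (br u). Qed.
Local Lemma b0l v : b 0 v = 0.
Proof. exact: linear_fun0 (bl v). Qed.
Local Lemma b_suml n (e : 'I_n -> V) (a : 'I_n -> R) v :
  b (\sum_(i < n) a i *: e i) v = \sum_(i < n) a i * b (e i) v.
Proof.
elim/big_ind2 : _ => [|x x' y y' <- <-|i _]; rewrite ?b0l ?bDl ?bZl//.
Qed.

(* With T the operator such that b w v = (T w, v), the inf-sup condition makes
   (w, z) |-> (T w, T z) coercive; if z represents g for this form then T z
   represents g for b. *)
Lemma transposed_solvable (g : V -> R) (G : R) : linear g ->
  (forall v, `|g v| <= G * `|v|) -> exists r, forall w, b w r = g w.
Proof.
move=> lg gG.
have ipN w : 1 * `|w| ^+ 2 <= ip w w by rewrite mul1r ip_norm.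
have ipB u v : `|ip u v| <= 1 * `|u| * `|v| by rewrite mul1r cauchy_schwarz.
have /choice[T TE] (w : V) : exists z, forall v, ip v z = b w v.
  exact: (riesz_representation ipl ipC ltr01 ipN ipB (br w) (b_bound w)).
have ip_inj z z' : (forall v, ip v z = ip v z') -> z = z'.
  move=> zz'; apply/eqP; rewrite -subr_eq0 -normr_eq0 -sqrf_eq0 ip_norm.
  by rewrite (linear_funB _ _ (ipl _)) zz' subrr.
have lT : linear T.
  move=> k u v; apply: ip_inj => w.
  by rewrite ipl !TE bDl bZl.
have ipTl u : linear (fun w => ip (T u) (T w)).
  by move=> k v w /=; rewrite lT ipl.
have Tlow w : beta * `|w| <= `|T w|.
  apply: inf_sup => // v; rewrite -TE mulrC; exact: cauchy_schwarz.
have Tup w : `|T w| <= Cb * `|w|.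
  have := b_bound w (T w); rewrite -TE -ip_norm ger0_norm ?sqr_ge0//.
  have [->|Tw0] := eqVneq (T w) 0; first by rewrite normr0 mulr_ge0.
  by rewrite expr2 ler_pM2r ?normr_gt0.
have Tcoer w : beta ^+ 2 * `|w| ^+ 2 <= ip (T w) (T w).
  by rewrite -ip_norm -exprMn ler_sqr ?nnegrE ?mulr_ge0// ltW.
have Tbound u v : `|ip (T u) (T v)| <= Cb ^+ 2 * `|u| * `|v|.
  rewrite (le_trans (cauchy_schwarz _ _))//.
  have -> : Cb ^+ 2 * `|u| * `|v| = Cb * `|u| * (Cb * `|v|) by ring.
  exact: ler_pM.
have [z zE] := riesz_representation ipTl (fun u v => ipC (T u) (T v))
  (exprn_gt0 2 beta0) Tcoer Tbound lg gG.
by exists (T z) => w; rewrite -TE ipC zE.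
Qed.

Variable (Vh : set V).
Hypothesis Vh_fin : fin_dim_subspace Vh.

Lemma fin_dim_subspaceP (a : R) u v : Vh u -> Vh v -> Vh (a *: u + v).
Proof.
have [n [e ->]] := Vh_fin => -[x ->] [y ->].
exists (fun i => a * x i + y i).
rewrite scaler_sumr -big_split/=; apply: eq_bigr => i _.
by rewrite scalerDl scalerA.
Qed.

(** The mixed problem for any operator [P] and any function [g] as load, so that differences,
    difference quotients and derivatives of solutions are again instances of it. *)
Definition saddle (P : V -> V) (g : V -> R) (r u : V) :=
  [/\ Vh u, forall v, b (P v) r + b u v = g v & forall vh, Vh vh -> b vh r = 0].

Lemma saddle_comb P g g' r r' u u' (a : R) : saddle P g r u -> saddle P g' r' u' ->
  saddle P (fun v => a * g v + g' v) (a *: r + r') (a *: u + u').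
Proof.
move=> [Vu gE Kr] [Vu' gE' Kr']; split.
- exact: fin_dim_subspaceP.
- by move=> v; rewrite bDr bDl bZr bZl -gE -gE'; lra.
- by move=> vh Vvh; rewrite bDr bZr Kr// Kr'// mulr0 addr0.
Qed.

(** The change of operator is moved into the load, tested against [r']; the difference then solves a
    problem with [P] alone, to which stability applies. *)
Lemma saddle_sub P P' g g' r r' u u' : saddle P g r u -> saddle P' g' r' u' ->
  saddle P (fun v => g v - g' v + b (P' v - P v) r') (r - r') (u - u').
Proof.
move=> [Vu gE Kr] [Vu' gE' Kr']; split.
- by rewrite -scaleN1r addrC; exact: fin_dim_subspaceP.
- move=> v; rewrite -gE -gE' -!(scaleN1r r') -!(scaleN1r u') -(scaleN1r (P v)).
  by rewrite !(bDr, bDl, bZr, bZl); ring.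
- by move=> vh Vvh; rewrite -scaleN1r bDr bZr Kr// Kr'// mulr0 addr0.
Qed.

(** * Bounds and solvability for one coercive operator *)

Section Bounds.
Variables (P : V -> V) (alpha : R).
Hypothesis alpha0 : 0 < alpha.
Hypothesis coercive : forall v, kernel_space b Vh v ->
  alpha * `|v| ^+ 2 <= `|b (P v) v|.

(** For [v = r] the term [b u r] vanishes, so [b (P r) r = g r] and coercivity applies. *)
Lemma saddle_bound1 g r u (G : R) : saddle P g r u -> 0 <= G ->
  (forall v, `|g v| <= G * `|v|) -> `|r| <= G / alpha.
Proof.
move=> [Vu gE Kr] G0 gG; have := coercive Kr.
have := gE r; rewrite (Kr _ Vu) addr0 => -> /le_trans/(_ (gG r)).
have [->|r0] := eqVneq r 0; first by rewrite normr0 divr_ge0// ltW.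
by rewrite expr2 mulrA ler_pM2r ?normr_gt0// ler_pdivlMr// mulrC.
Qed.

(** The inf-sup condition is applied to [u], since [b u v = g v - b (P v) r]. *)
Lemma saddle_bound2 g r u (G p rho : R) : saddle P g r u -> 0 <= G ->
  (forall v, `|g v| <= G * `|v|) -> 0 <= p -> (forall v, `|P v| <= p * `|v|) ->
  `|r| <= rho -> `|u| <= (G + Cb * p * rho) / beta.
Proof.
move=> [Vu gE Kr] G0 gG p0 pP rrho; rewrite ler_pdivlMr// mulrC.
have rho0 : 0 <= rho by rewrite (le_trans _ rrho).
apply: inf_sup => [|v]; first by rewrite addr_ge0// !mulr_ge0.
have -> : b u v = g v - b (P v) r by rewrite -gE addrC addKr.
rewrite (le_trans (ler_normB _ _))// mulrDl lerD//.
rewrite (le_trans (b_bound _ _))//.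
have -> : Cb * p * rho * `|v| = Cb * (p * `|v|) * rho by ring.
by rewrite ler_pM ?mulr_ge0// ler_wpM2l.
Qed.

Variables (Q : V -> V).
Hypotheses (PK : cancel P Q) (QK : cancel Q P) (lQ : linear Q).
Variable q : R.
Hypotheses (Qq : forall v, `|Q v| <= q * `|v|).

Lemma saddle_galerkin g r u : saddle P g r u ->
  Vh u /\ forall vh, Vh vh -> b u (Q vh) = g (Q vh).
Proof.
move=> [Vu gE Kr]; split=> // vh Vvh.
by rewrite -gE QK Kr// add0r.
Qed.

(** The multiplier solves [b w r = g (Q w) - b u (Q w)] for all [w]. For [w = P v] this is the first
    equation; for [w] in [Vh] the right-hand side is 0 by the Galerkin equations. *)
Lemma galerkin_saddle (g : V -> R) (G : R) u : linear g -> 0 <= G ->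
  (forall v, `|g v| <= G * `|v|) ->
  Vh u -> (forall vh, Vh vh -> b u (Q vh) = g (Q vh)) -> exists r, saddle P g r u.
Proof.
move=> lg G0 gG Vu uE.
have [| |r rE] := @transposed_solvable (fun w => g (Q w) - b u (Q w))
    (G * q + Cb * `|u| * q).
- move=> a v w; rewrite lQ lg bDr bZr -[a *: g (Q v)]/(a * g (Q v)).
  by rewrite -[RHS]/(a * (g (Q v) - b u (Q v)) + (g (Q w) - b u (Q w))); ring.
- move=> v; rewrite (le_trans (ler_normB _ _))// mulrDl lerD//.
    by rewrite (le_trans (gG _))// -mulrA ler_wpM2l.
  by rewrite (le_trans (b_bound _ _))// -(mulrA (Cb * `|u|)) ler_wpM2l ?mulr_ge0.
exists r; split=> // [v|vh Vvh]; first by rewrite rE PK subrK.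
by rewrite rE uE// subrr.
Qed.

(* A square linear system, whose adjoint is injective: if b u (Q v) = 0 for all
   u in Vh, then k := Q v lies in the kernel space and b (P k) k = b v k = 0. *)
Lemma galerkin_exists (g : V -> R) : linear g ->
  exists2 u, Vh u & forall vh, Vh vh -> b u (Q vh) = g (Q vh).
Proof.
move=> lg; have [n [e VhE]] := Vh_fin.
have QD x y : Q (x + y) = Q x + Q y by exact: linear_funD.
have QZ k x : Q (k *: x) = k *: Q x by exact: linear_funZ.
have Q0 : Q 0 = 0 by exact: linear_fun0.
have gD x y : g (x + y) = g x + g y by exact: linear_funD.
have gZ k x : g (k *: x) = k * g x by exact: (linear_funZ _ _ lg).
have g0 : g 0 = 0 by exact: linear_fun0 lg.
have gQ_sum (a : 'I_n -> R) :
    g (Q (\sum_(i < n) a i *: e i)) = \sum_(i < n) a i * g (Q (e i)).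
  by elim/big_ind2 : _ => [|x x' y y' <- <-|i _]; rewrite ?Q0 ?QD ?QZ ?gD ?gZ.
have bQ_sum u (a : 'I_n -> R) :
    b u (Q (\sum_(i < n) a i *: e i)) = \sum_(i < n) a i * b u (Q (e i)).
  elim/big_ind2 : _ => [|x x' y y' <- <-|i _].
  - by rewrite Q0 b0r.
  - by rewrite QD bDr.
  - by rewrite QZ bZr.
pose A : 'M[R]_n := \matrix_(i, j) b (e i) (Q (e j)).
pose F : 'rV[R]_n := \row_j g (Q (e j)).
(* [F] is in the row space of [A] once it annihilates each column [y] of the cokernel matrix. The
   [e k] may be dependent: what vanishes is their combination with coefficients [y], and this
   suffices. *)
have : (F <= A)%MS.
  rewrite submxE; apply/eqP/matrixP => i j; rewrite !mxE.
  pose y k := cokermx A k j.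
  have y0 : \sum_(k < n) y k *: e k = 0.
    set v := \sum_(k < n) y k *: e k.
    have Vv : Vh v by rewrite VhE; exists y.
    have KQv : kernel_space b Vh (Q v).
      move=> vh; rewrite VhE => -[a ->]; rewrite b_suml big1// => k _.
      have /matrixP/(_ k j) := mulmx_coker A; rewrite !mxE => Ay.
      rewrite bQ_sum; rewrite [X in _ * X](_ : _ = 0) ?mulr0//.
      by rewrite -[RHS]Ay; apply: eq_bigr => l _; rewrite mxE mulrC.
    have := coercive KQv; rewrite QK (KQv _ Vv) normr0.
    rewrite pmulr_rle0// => Qv0.
    have : Q v = 0.
      apply/eqP; rewrite -normr_eq0 -sqrf_eq0; apply/eqP/le_anti.
      by rewrite Qv0 sqr_ge0.
    by move=> Qv; rewrite -(QK v) Qv -Q0 QK.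
  transitivity (g (Q (\sum_(k < n) y k *: e k))); last by rewrite y0 Q0 g0.
  by rewrite gQ_sum; apply: eq_bigr => k _; rewrite mxE mulrC.
move=> /submxP[x xA].
exists (\sum_(i < n) x 0 i *: e i); first by rewrite VhE; exists (x 0).
move=> vh; rewrite VhE => -[a ->]; rewrite gQ_sum bQ_sum.
apply: eq_bigr => j _; congr (_ * _); rewrite b_suml.
have /matrixP/(_ 0 j) := xA; rewrite !mxE => ->.
by apply: eq_bigr => k _; rewrite mxE.
Qed.

Lemma saddle_exists (g : V -> R) (G : R) : linear g -> 0 <= G ->
  (forall v, `|g v| <= G * `|v|) -> exists r u, saddle P g r u.
Proof.
move=> lg G0 gG; have [u Vu uE] := galerkin_exists lg.
by have [r ru] := galerkin_saddle lg G0 gG Vu uE; exists r, u.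
Qed.

End Bounds.

(** The constant is fixed before [P], hence uniform over all operators sharing [alpha] and [p]; it
    adds the constants for [r] and for [u]. *)
Lemma saddle_stable (alpha p : R) : 0 < alpha -> 0 <= p ->
  exists2 K : R, 0 <= K & forall (P : V -> V),
    (forall v, kernel_space b Vh v -> alpha * `|v| ^+ 2 <= `|b (P v) v|) ->
    (forall v, `|P v| <= p * `|v|) ->
    forall g r u (G : R), 0 <= G -> saddle P g r u ->
    (forall v, `|g v| <= G * `|v|) -> `|r| <= K * G /\ `|u| <= K * G.
Proof.
move=> alpha0 p0; pose k := (1 + Cb * p / alpha) / beta.
have a0 : 0 <= alpha^-1 by rewrite invr_ge0 ltW.
have k0 : 0 <= k.
  apply: divr_ge0; last exact: ltW.
  by apply: addr_ge0 => //; apply: divr_ge0; [exact: mulr_ge0|exact: ltW].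
exists (alpha^-1 + k) => [|P coP pP g r u G G0 s gG]; first exact: addr_ge0.
have rG := saddle_bound1 alpha0 coP s G0 gG.
split; first by rewrite (le_trans rG)// mulrC ler_wpM2r// lerDl.
rewrite (le_trans (saddle_bound2 s G0 gG p0 pP rG))//.
have -> : (G + Cb * p * (G / alpha)) / beta = k * G.
  by rewrite /k; field; rewrite !gt_eqF.
by rewrite ler_wpM2r// lerDr.
Qed.

End SaddlePoint.

(** * Differentiability with respect to the weight *)

(** Composition with [phi] reduces this to the scalar mean value theorem along the segment from [y]
    to [x], where directional derivatives are enough. *)
Lemma gateaux_mean_value (R : realType) (X W : normedModType R) (G : X -> W)
    (phi : W -> R) (c C : R) (x y : X) :
  gateaux G -> 0 <= c -> linear phi -> (forall w, `|phi w| <= c * `|w|) ->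
  (forall xi, opnorm (fun eta => 'D_eta G xi) <= C) ->
  `|phi (G x - G y)| <= c * C * `|x - y|.
Proof.
move=> dG c0 lphi phic GC.
pose p (t : R) := y + t *: (x - y).
pose dh t := phi ('D_(x - y) G (p t)).
have dhP (t : R) : is_derive t 1 (phi \o G \o p) (dh t).
  have dhc : s^-1 *: (((phi \o G \o p) \o shift t) (s *: 1) - (phi \o G \o p) t)
      @[s --> 0^'] --> dh t.
    rewrite (_ : (fun s => _) =
        phi \o (fun s => s^-1 *: ((G \o shift (p t)) (s *: (x - y)) - G (p t)))).
      apply: continuous_cvg; first exact: (linear_bound_continuous lphi).
      by have [dGx _ _] := dG (p t); exact: dGx.
    apply/funext => s /=; rewrite (linear_funZ _ _ lphi) (linear_funB _ _ lphi).
    congr (_ *: (phi (G _) - _)).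
    by rewrite /p -[s *: 1]/(s * 1) mulr1 scalerDl addrCA.
  split; first by apply/cvg_ex; exists (dh t).
  exact: cvg_lim dhc.
have hcont : {within `[0, 1], continuous (phi \o G \o p)}.
  apply: continuous_subspaceT => t.
  apply: differentiable_continuous; apply/derivable1_diffP.
  by have [] := dhP t.
have [t _] := MVT ltr01 (fun t _ => dhP t) hcont.
rewrite /= /p scale0r addr0 scale1r (addrC y) subrK subr0 mulr1.
rewrite (linear_funB _ _ lphi) => ->.
have [_ lG cG] := dG (p t).
rewrite (le_trans (phic _))// -mulrA ler_wpM2l//.
by rewrite (le_trans (le_opnorm (x - y) lG cG))// ler_wpM2r.
Qed.

(** * The solution map as a function of the parameter *)

Section ParametricSaddlePoint.
Variables (R : realType) (V : completeNormedModType R) (W X : normedModType R).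
Variables (b : V -> V -> R) (Vh : set V).
Hypotheses (br : forall u, linear (b u)) (bl : forall v, linear (b^~ v)).
Hypothesis Vh_fin : fin_dim_subspace Vh.
Variable M : W -> V -> V.
Hypotheses (Ml : forall v, linear (M^~ v)) (Mr : forall w, linear (M w)).
Variable c : R.
Hypotheses (c0 : 0 <= c)
  (bM_bound : forall w v r, `|b (M w v) r| <= c * `|w| * `|v| * `|r|).
Variables (varpi : X -> W).
Variable K : R.
Hypotheses (K0 : 0 <= K)
  (stable : forall xi g r u G, 0 <= G -> saddle b Vh (M (varpi xi)) g r u ->
     (forall v, `|g v| <= G * `|v|) -> `|r| <= K * G /\ `|u| <= K * G)
  (solvable : forall xi (g : V -> R) G, linear g -> 0 <= G ->
     (forall v, `|g v| <= G * `|v|) ->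
     exists r u, saddle b Vh (M (varpi xi)) g r u).
Variables (f : V -> R) (F : R).
Hypotheses (F0 : 0 <= F) (f_bound : forall v, `|f v| <= F * `|v|).
Variables rho S : X -> V.
Hypothesis rhoS : forall xi, saddle b Vh (M (varpi xi)) f (rho xi) (S xi).

Local Lemma bMDw w w' v r : b (M (w + w') v) r = b (M w v) r + b (M w' v) r.
Proof. by rewrite (linear_funD _ _ (Ml v)) (linear_funD _ _ (bl r)). Qed.
Local Lemma bMNw w v r : b (M (- w) v) r = - b (M w v) r.
Proof. by rewrite (linear_funN _ (Ml v)) [LHS](linear_funN _ (bl r)). Qed.
Local Lemma bMZw k w v r : b (M (k *: w) v) r = k * b (M w v) r.
Proof. by rewrite (linear_funZ _ _ (Ml v)) [LHS](linear_funZ _ _ (bl r)). Qed.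
Local Lemma bMDr w v r r' : b (M w v) (r + r') = b (M w v) r + b (M w v) r'.
Proof. exact: linear_funD. Qed.
Local Lemma bMNr w v r : b (M w v) (- r) = - b (M w v) r.
Proof. exact: linear_funN. Qed.
Local Lemma bMBP w w' v r : b (M w v - M w' v) r = b (M (w - w') v) r.
Proof. by rewrite (linear_funB _ _ (Ml v)). Qed.

Lemma saddle_unique xi g g' r r' u u' : saddle b Vh (M (varpi xi)) g r u ->
  saddle b Vh (M (varpi xi)) g' r' u' -> g =1 g' -> r = r' /\ u = u'.
Proof.
move=> s s' gg'.
have [v|] := stable (lexx 0) (saddle_sub br bl Vh_fin s s').
  by rewrite gg' !subrr add0r [X in `|X|](linear_fun0 (bl r')) normr0 mul0r.
rewrite mulr0 !normr_le0 !subr_eq0 => /eqP-> /eqP->//.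
Qed.

Lemma rho_bound xi : `|rho xi| <= K * F.
Proof. by have [] := stable F0 (rhoS xi) f_bound. Qed.

(** The difference solves the problem at [xi] with load [b (M (varpi zeta - varpi xi) v) (rho
    zeta)]. The constant [C] is left open: it comes from a difference quotient for differentiability
    and from the mean value theorem for the Lipschitz estimate. *)
Lemma rho_sub_bound xi zeta (C : R) : 0 <= C ->
  (forall v r, `|b (M (varpi zeta - varpi xi) v) r| <= C * `|v| * `|r|) ->
  `|rho xi - rho zeta| <= K * (C * (K * F)).
Proof.
move=> C0 hC.
have [v|//] := stable (mulr_ge0 C0 (mulr_ge0 K0 F0))
  (saddle_sub br bl Vh_fin (rhoS xi) (rhoS zeta)).
rewrite subrr add0r bMBP (le_trans (hC _ _))// mulrAC ler_wpM2r// ler_wpM2l//.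
exact: rho_bound.
Qed.

Hypothesis dvarpi : gateaux varpi.

Let load xi eta (v : V) : R := - b (M ('D_eta varpi xi) v) (rho xi).

Let loadP xi eta : linear (load xi eta) /\
  forall v, `|load xi eta v| <= c * `|'D_eta varpi xi| * (K * F) * `|v|.
Proof.
split=> [a u v|v].
  rewrite /load Mr (linear_funD _ _ (bl _)) [b (a *: _) _](linear_funZ _ _ (bl _)).
  by rewrite opprD scalerN.
rewrite /load normrN (le_trans (bM_bound _ _ _))// mulrAC.
by rewrite ler_wpM2r// ler_wpM2l ?mulr_ge0// rho_bound.
Qed.

(** The candidate derivatives are chosen separately for each [eta]; linearity in [eta] is recovered
    later from uniqueness. *)
Let dex xi : {rs : X -> V * V | forall eta,
  saddle b Vh (M (varpi xi)) (load xi eta) (rs eta).1 (rs eta).2}.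
Proof.
suff /choice[rs rsP] (eta : X) : exists rs : V * V,
    saddle b Vh (M (varpi xi)) (load xi eta) rs.1 rs.2 by exists rs.
have [lg gB] := loadP xi eta.
have [|r [u ru]] := solvable xi lg _ gB; last by exists (r, u).
by rewrite !mulr_ge0.
Qed.

Let drho xi eta : V := (sval (dex xi) eta).1.
Let dS xi eta : V := (sval (dex xi) eta).2.

Let drho_dS xi eta :
  saddle b Vh (M (varpi xi)) (load xi eta) (drho xi eta) (dS xi eta).
Proof. exact: (svalP (dex xi) eta). Qed.

Let d_bound xi eta : `|drho xi eta| <= K * (c * `|'D_eta varpi xi| * (K * F)) /\
  `|dS xi eta| <= K * (c * `|'D_eta varpi xi| * (K * F)).
Proof.
have [_ gB] := loadP xi eta.
by apply: stable (drho_dS xi eta) gB; rewrite !mulr_ge0.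
Qed.

Let dS_cvg xi eta :
  h^-1 *: ((S \o shift xi) (h *: eta) - S xi) @[h --> 0^'] --> dS xi eta.
Proof.
pose w' := 'D_eta varpi xi.
pose dq (h : R) := h^-1 *: ((varpi \o shift xi) (h *: eta) - varpi xi).
have dq_cvg : dq h @[h --> 0^'] --> w' by have [/(_ eta) + _ _] := dvarpi xi.
(* The first term is the error of the difference quotient of the weight, the second the change of
   the multiplier, of order [|h|]. *)
pose err (h : R) := c * (K * F) * `|dq h - w'|
                  + c * `|w'| * (K * (c * (`|h| * `|dq h|) * (K * F))).
have err0 : K * err h @[h --> 0^'] --> 0.
  have h0 : h @[h --> (0 : R)^'] --> (0 : R) by move=> A; exact: nbhs_dnbhs.
  have : K * err h @[h --> 0^'] --> K * (c * (K * F) * `|w' - w'|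
      + c * `|w'| * (K * (c * (`|0 : R| * `|w'|) * (K * F)))).
    apply: cvgMr; apply: cvgD.
      by apply: cvgMr; exact: cvg_norm (cvgB dq_cvg (cvg_cst w')).
    apply: cvgMr; apply: cvgMr; apply: cvgMl; apply: cvgMr; apply: cvgM.
      exact: (cvg_norm h0).
    exact: (cvg_norm dq_cvg).
  by rewrite subrr !normr0 !(mul0r, mulr0) addr0 mulr0.
apply/subr_cvg0/norm_cvg0P; apply: (@squeeze_cvgr _ _ _ _ (cst 0) (fun h => K * err h)).
- near=> h; rewrite normr_ge0 /=.
  have hn0 : h != 0 by near: h; exact: nbhs_dnbhs_neq.
  set xh := h *: eta + xi.
  have varpiE : varpi xh - varpi xi = h *: dq h.
    by rewrite /dq scalerA divff// scale1r.
  have rh : `|rho xh - rho xi| <= K * (c * (`|h| * `|dq h|) * (K * F)).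
    apply: rho_sub_bound => [|v r]; first by rewrite !mulr_ge0.
    by rewrite -opprB varpiE bMNw normrN (le_trans (bM_bound _ _ _))// normrZ.
  (* This order of subtraction keeps the operator at [varpi xi], as in the derivative problem. The
     second component in [s2] is then minus the error of the difference quotient of [S]. *)
  have s1 := saddle_sub br bl Vh_fin (rhoS xi) (rhoS xh).
  have s2 := saddle_comb br bl Vh_fin h^-1 s1 (drho_dS xi eta).
  have err_ge0 : 0 <= err h by rewrite addr_ge0 ?mulr_ge0.
  have [v|_] := stable err_ge0 s2; last first.
    rewrite -normrN; congr (`|_| <= _).
    by rewrite opprD -scalerN opprB.
  rewrite /load subrr add0r bMBP varpiE bMZw mulrA mulVf// mul1r.
  have -> : b (M (dq h) v) (rho xh) - b (M w' v) (rho xi) =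
      b (M (dq h - w') v) (rho xh) + b (M w' v) (rho xh - rho xi).
    by rewrite bMDw bMNw bMDr bMNr; ring.
  rewrite (le_trans (ler_normD _ _))// /err mulrDl lerD//.
    rewrite (le_trans (bM_bound _ _ _))//.
    have -> : c * (K * F) * `|dq h - w'| * `|v| = c * `|dq h - w'| * `|v| * (K * F).
      by ring.
    by rewrite ler_wpM2l ?mulr_ge0// rho_bound.
  rewrite (le_trans (bM_bound _ _ _))// mulrAC.
  by rewrite ler_wpM2r// ler_wpM2l ?mulr_ge0.
- exact: cvg_cst.
- exact: err0.
Unshelve. all: by end_near. Qed.

Let derive_S xi eta : 'D_eta S xi = dS xi eta.
Proof. by apply: cvg_lim => //; exact: dS_cvg. Qed.

Let derive_bound xi eta : `|'D_eta S xi| <= K * c * K * F * `|'D_eta varpi xi|.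
Proof.
rewrite derive_S; have [_ /le_trans->//] := d_bound xi eta.
by rewrite le_eqVlt; apply/orP; left; apply/eqP; ring.
Qed.

(** The load is linear in [eta], hence so is the unique solution. *)
Let derive_linear xi : linear (fun eta => 'D_eta S xi).
Proof.
move=> a eta eta'; rewrite !derive_S.
have s := saddle_comb br bl Vh_fin a (drho_dS xi eta) (drho_dS xi eta').
have [|_ ->//] := saddle_unique (drho_dS xi (a *: eta + eta')) s.
have [_ lD _] := dvarpi xi.
by move=> v; rewrite /load lD bMDw bMZw opprD mulrN.
Qed.

Lemma saddle_gateaux : gateaux S.
Proof.
move=> xi; split; [|exact: derive_linear|].
  by move=> eta; apply/cvg_ex; exists (dS xi eta); exact: dS_cvg.
have [_ lD cD] := dvarpi xi.
have [C C0 hC] := linear_continuous_bound lD cD.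
apply: (@linear_bound_continuous _ _ _ _ (K * c * K * F * C)).
  exact: derive_linear.
move=> eta; rewrite (le_trans (derive_bound xi eta))// -(mulrA (K * c * K * F)).
by rewrite ler_wpM2l ?mulr_ge0.
Qed.

Lemma saddle_derive_subspace xi eta : Vh ('D_eta S xi).
Proof. by rewrite derive_S; have [] := drho_dS xi eta. Qed.

Lemma saddle_bounded_derivative :
  bounded_derivative varpi -> bounded_derivative S.
Proof.
move=> [C CP]; exists (K * c * K * F * `|C|) => xi.
apply: opnorm_le => [|eta]; first by rewrite !mulr_ge0.
rewrite (le_trans (derive_bound xi eta))// -(mulrA (K * c * K * F)) ler_wpM2l ?mulr_ge0//.
have [_ lD cD] := dvarpi xi.
rewrite (le_trans (le_opnorm eta lD cD))// ler_wpM2r//.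
by rewrite (le_trans (CP xi))// ler_norm.
Qed.

(** The difference of the derivatives at [xi] and [zeta] solves the problem at [xi] with a load of
    three terms: the changes of [varpi'] ([t1]), of the multiplier ([t2]) and of the operator
    ([t3]). The last two have the same constant, whence the factor 2. *)
Lemma saddle_lipschitz_derivative : bounded_derivative varpi ->
  lipschitz_derivative varpi -> lipschitz_derivative S.
Proof.
move=> [C' CP'] [L' LP'].
pose C := `|C'|; pose L := `|L'|.
have C0 : 0 <= C by exact: normr_ge0.
have L0 : 0 <= L by exact: normr_ge0.
have CP xi : opnorm (fun eta => 'D_eta varpi xi) <= C.
  by rewrite (le_trans (CP' xi))// ler_norm.
have DB xi eta : `|'D_eta varpi xi| <= C * `|eta|.
  have [_ lD cD] := dvarpi xi.
  by rewrite (le_trans (le_opnorm eta lD cD))// ler_wpM2r.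
have DL xi zeta eta :
    `|'D_eta varpi xi - 'D_eta varpi zeta| <= L * `|xi - zeta| * `|eta|.
  have [_ lD cD] := dvarpi xi; have [_ lD' cD'] := dvarpi zeta.
  have lDD : linear (fun eta => 'D_eta varpi xi - 'D_eta varpi zeta).
    by move=> a u v; rewrite lD lD' scalerBr addrACA opprD.
  have cDD : continuous (fun eta => 'D_eta varpi xi - 'D_eta varpi zeta).
    by move=> u; apply: cvgB; [exact: cD|exact: cD'].
  rewrite (le_trans (le_opnorm eta lDD cDD))// ler_wpM2r//.
  by rewrite (le_trans (LP' xi zeta))// ler_wpM2r// ler_norm.
have mv xi zeta v r :
    `|b (M (varpi zeta - varpi xi) v) r| <= c * C * `|xi - zeta| * `|v| * `|r|.
  have -> : c * C * `|xi - zeta| * `|v| * `|r| = c * `|v| * `|r| * C * `|zeta - xi|.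
    by rewrite (distrC xi); ring.
  apply: (gateaux_mean_value (phi := fun w => b (M w v) r) zeta xi dvarpi) CP.
  - by rewrite !mulr_ge0.
  - by move=> a w w' /=; rewrite bMDw bMZw.
  - move=> w; rewrite (le_trans (bM_bound _ _ _))//.
    by rewrite le_eqVlt; apply/orP; left; apply/eqP; ring.
exists (K * (c * L * (K * F) + 2 * (c * C * (K * (c * C * (K * F)))))) => xi zeta.
pose e := `|xi - zeta|.
have e0 : 0 <= e by exact: normr_ge0.
have rd : `|rho xi - rho zeta| <= K * (c * C * e * (K * F)).
  by apply: rho_sub_bound => [|v r]; rewrite ?mulr_ge0.
apply: opnorm_le => [|eta].
  by rewrite !mulr_ge0// addr_ge0// !mulr_ge0.
rewrite !derive_S.
pose G := (c * L * (K * F) + 2 * (c * C * (K * (c * C * (K * F))))) * e * `|eta|.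
have G0 : 0 <= G by rewrite !mulr_ge0// addr_ge0// !mulr_ge0.
have -> : K * (c * L * (K * F) + 2 * (c * C * (K * (c * C * (K * F))))) * e * `|eta|
    = K * G by rewrite /G; ring.
have s := saddle_sub br bl Vh_fin (drho_dS xi eta) (drho_dS zeta eta).
have [v|//] := stable G0 s.
rewrite bMBP /load.
set w1 := 'D_eta varpi xi; set w2 := 'D_eta varpi zeta.
have -> : - b (M w1 v) (rho xi) - - b (M w2 v) (rho zeta) =
    - b (M (w1 - w2) v) (rho xi) - b (M w2 v) (rho xi - rho zeta).
  by rewrite bMDw bMNw bMDr bMNr; ring.
have t1 : `|b (M (w1 - w2) v) (rho xi)| <= c * L * (K * F) * e * `|eta| * `|v|.
  rewrite (le_trans (bM_bound _ _ _))//.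
  have -> : c * L * (K * F) * e * `|eta| * `|v| =
      c * (L * e * `|eta|) * `|v| * (K * F) by ring.
  apply: ler_pM; rewrite ?mulr_ge0//; last exact: rho_bound.
  by rewrite ler_wpM2r// ler_wpM2l//; exact: DL.
have t2 : `|b (M w2 v) (rho xi - rho zeta)| <=
    c * C * (K * (c * C * (K * F))) * e * `|eta| * `|v|.
  rewrite (le_trans (bM_bound _ _ _))//.
  have -> : c * C * (K * (c * C * (K * F))) * e * `|eta| * `|v| =
      c * (C * `|eta|) * `|v| * (K * (c * C * e * (K * F))) by ring.
  apply: ler_pM; rewrite ?mulr_ge0//.
  by rewrite ler_wpM2r// ler_wpM2l//; exact: DB.
have t3 : `|b (M (varpi zeta - varpi xi) v) (drho zeta eta)| <=
    c * C * (K * (c * C * (K * F))) * e * `|eta| * `|v|.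
  rewrite (le_trans (mv _ _ _ _))// -/e.
  have -> : c * C * (K * (c * C * (K * F))) * e * `|eta| * `|v| =
      c * C * e * `|v| * (K * (c * (C * `|eta|) * (K * F))) by ring.
  rewrite ler_wpM2l ?mulr_ge0//; have [db _] := d_bound zeta eta.
  rewrite (le_trans db)//.
  by rewrite ler_wpM2l// ler_wpM2r ?mulr_ge0// ler_wpM2l//; exact: DB.
rewrite (le_trans (ler_normD _ _))//.
have t12 := ler_normB (- b (M (w1 - w2) v) (rho xi)) (b (M w2 v) (rho xi - rho zeta)).
rewrite normrN in t12.
rewrite /G; lra.
Qed.

End ParametricSaddlePoint.

(** * Multiplication by a weight *)

Section FunctionSpaceMultiplication.
Context d (T : measurableType d) (R : realType) (mu : {measure set T -> \bar R}).
Variables (W V : normedModType R).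
Variables (fnW : W -> {mfun T >-> R}) (fnV : V -> {mfun T >-> R}).
Hypotheses (W_fun : function_space mu fnW) (V_fun : function_space mu fnV).

Let aeI (P Q : T -> Prop) : {ae mu, forall x, P x} -> {ae mu, forall x, Q x} ->
  {ae mu, forall x, P x /\ Q x}.
Proof. exact: filterS2. Qed.

Lemma function_space_eq (u v : V) :
  {ae mu, forall x, fnV u x = fnV v x} -> u = v.
Proof.
have [fl f0 _] := V_fun; move=> uv.
apply/eqP; rewrite -subr_eq0 addrC -scaleN1r; apply/eqP/f0.
apply: filterS2 uv (fl (-1) v u) => x /= uvx /(_ I) -> _.
by rewrite uvx mulN1r addNr.
Qed.

Variable M : W -> V -> V.
Hypothesis M_mul : multiplication mu fnW fnV M.

Let fnM w v : {ae mu, forall x, fnV (M w v) x = fnW w x * fnV v x}.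
Proof.
by have [/(_ v) h _ _] := M_mul w; apply: filterS h => x; exact.
Qed.

(** Linearity in the weight is not part of [multiplication]; it is read off the functions almost
    everywhere. *)
Lemma multiplication_linearl v : linear (M^~ v).
Proof.
move=> a w w'; apply: function_space_eq.
have [lV _ _] := V_fun; have [lW _ _] := W_fun.
have h1 := aeI (fnM (a *: w + w') v) (lV a (M w v) (M w' v)).
have h2 := aeI (fnM w v) (fnM w' v).
apply: filterS (aeI (aeI h1 h2) (lW a w w')).
by move=> x [[[-> /(_ I)->] [-> ->]] /(_ I)->]; rewrite mulrDl mulrA.
Qed.

Lemma multiplication_closed (s : nat -> W) w v y : s @ \oo --> w ->
  M (s n) v @[n --> \oo] --> y -> y = M w v.
Proof.
move=> sw My; have [_ _ cW] := W_fun; have [_ _ cV] := V_fun.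
have subseq (phi : nat -> nat) : {homo phi : m n / (m < n)%N} -> phi @ \oo --> \oo.
  move=> phi_homo; have phi_ge n : (n <= phi n)%N.
    by elim: n => // n IH; rewrite (leq_ltn_trans IH)// phi_homo.
  move=> A [N _ NA]; exists N => // n /= Nn; apply: NA => /=.
  exact: leq_trans Nn (phi_ge n).
(* Along [phi] the weights converge almost everywhere, and along a further subsequence [psi] so do
   the products; the limits are compared pointwise. *)
have [phi phi_homo aeW] := cW _ _ sw.
have Mphi : M (s (phi n)) v @[n --> \oo] --> y.
  by apply: (cvg_comp phi _ _ My); exact: subseq.
have [psi psi_homo aeV] := cV _ _ Mphi.
have aeM := ae_foralln (fun n => fnM (s n) v).
apply: function_space_eq.
apply: filterS (aeI (aeI aeW aeV) (aeI aeM (fnM w v))).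
move=> x [[Wx Vx] [Mx ->]].
apply/esym; apply: (cvg_unique _ _ Vx) => //.
rewrite (_ : (fun n => _) = (fun n => fnW (s (phi (psi n))) x * fnV v x)); last first.
  by apply/funext => n; rewrite Mx.
by apply: cvgMl; apply: (cvg_comp psi _ _ Wx); exact: subseq.
Qed.

(** The positive lower bound of the weight makes its values invertible almost everywhere. *)
Lemma multiplication_reciprocal w w' : Wplus mu fnW w -> is_reciprocal mu fnW w w' ->
  cancel (M w) (M w') /\ cancel (M w') (M w).
Proof.
move=> [c c0 wc] ww'; split=> v; apply: function_space_eq;
  [have h := aeI (fnM w' (M w v)) (fnM w v)
  |have h := aeI (fnM w (M w' v)) (fnM w' v)];
  apply: filterS (aeI h (aeI wc ww')) => x
    [[-> ->] [/andP[/(lt_le_trans c0) wx _] /(_ I) ->]].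
  by rewrite mulKf// gt_eqF.
by rewrite mulVKf// gt_eqF.
Qed.

End FunctionSpaceMultiplication.

(** * Well-posedness from a stability estimate *)

Section WellPosed.
Variables (R : realType) (V Z : normedModType R).

(** The estimate with [G = 0] gives uniqueness, and with [G] the operator norm of [g \- f]
    continuous dependence. *)
Lemma well_posed_stable (P : {linear V -> R} -> Z -> Prop) (K : R) : 0 <= K ->
  (forall f : {linear V -> R}, continuous f -> exists z, P f z) ->
  (forall (f g : {linear V -> R}) z z' (G : R), continuous f /\ P f z ->
     continuous g /\ P g z' -> 0 <= G ->
     (forall v, `|g v - f v| <= G * `|v|) -> `|z' - z| <= K * G) ->
  well_posed P.
Proof.
move=> K0 Pex Pst; split=> [f cf|f z cf Pf e e0].
  have [z Pz] := Pex f cf; exists z; split=> // z' Pz'.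
  have := Pst _ _ _ _ 0 (conj cf Pz') (conj cf Pz) (lexx 0).
  rewrite mulr0 normr_le0 subr_eq0 => h; apply/eqP/h => v.
  by rewrite subrr normr0 mul0r.
(* [K + 1] replaces [K], which may be 0. *)
exists (e / (K + 1)) => [|g z' cg Pg fg].
  by rewrite divr_gt0// ltr_wpDl.
have lfg : linear (g \- f).
  have lf : linear (f : V -> R) by move=> a u v; exact: linearP.
  have lg : linear (g : V -> R) by move=> a u v; exact: linearP.
  by move=> a u v /=; rewrite lf lg scalerBr opprD addrACA.
have cfg : continuous (g \- f) by move=> v; apply: cvgB; [exact: cg|exact: cf].
have o0 := opnorm_ge0 lfg cfg.
rewrite (le_lt_trans (Pst _ _ _ _ _ (conj cf Pf) (conj cg Pg) o0 _))//.
  by move=> v; exact: (le_opnorm v lfg cfg).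
move: fg; rewrite ltr_pdivlMr ?ltr_wpDl// => /(le_lt_trans _); apply.
by rewrite mulrC ler_wpM2l// lerDl.
Qed.

End WellPosed.

Theorem proposition3p4 (R : realType) (d : nat)
  (Omega : set (d.-tuple (measurableTypeR R))) (mOmega : measurable Omega)
  (mu := mrestr (lebesgue_Rn R d) mOmega)
  (V : completeNormedModType R) (ip : {dot V for idfun})
  (ip_norm : forall v : V, `|v| ^+ 2 = ip v v)
  (fnV : V -> {mfun d.-tuple (measurableTypeR R) >-> R})
  (V_fun : function_space mu fnV)
  (b : {bilinear V -> V -> R})
  (b_cont : continuous (fun p : V * V => b p.1 p.2))
  (beta : R) (beta_gt0 : 0 < beta)
  (inf_sup : forall w : V,
     beta * `|w| <= sup [set b w v / `|v| | v in [set v | v != 0]])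
  (nondeg : [set v : V | forall w, b w v = 0] = [set 0])
  (Vh : set V) (Vh_fin : fin_dim_subspace Vh)
  (W : completeNormedModType R)
  (fnW : W -> {mfun d.-tuple (measurableTypeR R) >-> R})
  (W_fun : function_space mu fnW)
  (M : W -> V -> V) (M_mul : multiplication mu fnW fnV M)
  (W_recip : forall w, Wplus mu fnW w ->
     exists2 w', Wplus mu fnW w' & is_reciprocal mu fnW w w')
  (varpi : L2 mu -> W) (varpi_Wplus : forall xi, Wplus mu fnW (varpi xi))
  (alpha_h : L2 mu -> R) (alpha_h_gt0 : forall xi, 0 < alpha_h xi)
  (varpi_coercive : forall xi v, kernel_space b Vh v ->
     alpha_h xi * `|v| ^+ 2 <= `|b (M (varpi xi) v) v|)
  (omega := fun xi => recip mu fnW (varpi xi))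
  (S := fun (f : {linear V -> R}) (xi : L2 mu) =>
     galerkin_sol b Vh (M (omega xi)) f) :
  [/\ forall xi,
        [/\ well_posed (galerkin b Vh (M (omega xi))),
            well_posed (mixed b Vh (M (varpi xi))) &
            forall (f : {linear V -> R}) u, continuous f ->
              galerkin b Vh (M (omega xi)) f u <->
              exists r, mixed b Vh (M (varpi xi)) f (r, u)] &
      forall (alpha varpi_oo : R), 0 < alpha -> 0 < varpi_oo ->
        (forall xi, alpha <= alpha_h xi) ->
        (forall xi, `|varpi xi| <= varpi_oo) ->
        forall f : {linear V -> R}, continuous f ->
          (exists C : R, forall xi, `|S f xi| <= C) /\
          (gateaux varpi ->
             (gateaux (S f) /\ forall xi eta, Vh ('D_eta (S f) xi)) /\
             (bounded_derivative varpi -> lipschitz_derivative varpi ->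
                bounded_derivative (S f) /\ lipschitz_derivative (S f)))].

Proof.

(* Reduction of the weighted problems to the abstract estimates *)
have ipl u : linear (ip u) by move=> a v w; exact: linearPr.
have ipC u v : ip u v = ip v u.
  by rewrite (hermC ip) expr0 mul1r.
have br u : linear (b u : V -> R) by move=> a v w; exact: linearPr.
have bl v : linear (b^~ v : V -> R) by move=> a u w; exact: linearPl.
have [Cb Cb0 bB] := bilinear_continuous_bound br bl b_cont.
(* The inf-sup condition without supremum; in the zero space the supremum is the default 0. *)
have b_inf_sup w (C : R) : 0 <= C -> (forall v, `|b w v| <= C * `|v|) ->
    beta * `|w| <= C.
  move=> C0 bC; rewrite (le_trans (inf_sup w))//.
  have [->|/set0P ne] := eqVneq [set b w v / `|v| | v in [set v | v != 0]] set0.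
    by rewrite sup0.
  apply: ge_sup => // _ [v /= v0 <-].
  by rewrite ler_pdivrMr ?normr_gt0// (le_trans (ler_norm _)).
have Ml v : linear (M^~ v) := multiplication_linearl W_fun V_fun M_mul v.
have Mr w : linear (M w) by have [] := M_mul w.
have [CM CM0 MB] : exists2 C, 0 <= C & forall w v, `|M w v| <= C * `|w| * `|v|.
  apply: closed_graph_bilinear_bound Ml _ _.
    move=> w; have [_ lM cM] := M_mul w.
    by have [C _ MC] := linear_continuous_bound lM cM; exists C.
  by move=> s w u y; exact: (multiplication_closed W_fun V_fun M_mul).
(* A reciprocal exists in [W], so [recip] does not fall back on its default value. *)
have omegaP xi : is_reciprocal mu fnW (varpi xi) (omega xi).
  have [w' _ ww'] := W_recip _ (varpi_Wplus xi).
  by apply: (xgetPex 0); exists w'.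
have PK xi : cancel (M (varpi xi)) (M (omega xi)) /\
    cancel (M (omega xi)) (M (varpi xi)).
  exact: (multiplication_reciprocal V_fun M_mul (varpi_Wplus xi) (omegaP xi)).
have lcb (f : {linear V -> R}) : continuous f ->
    linear (f : V -> R) /\ exists2 F, 0 <= F & forall v, `|f v| <= F * `|v|.
  move=> cf; have lf : linear (f : V -> R) by move=> a u v; exact: linearP.
  by split=> //; exact: linear_continuous_bound.
have galP xi (f : {linear V -> R}) u : continuous f ->
    galerkin b Vh (M (omega xi)) f u <->
    exists r, mixed b Vh (M (varpi xi)) f (r, u).
  move=> /lcb[lf [F F0 fF]]; have [K1 K2] := PK xi.
  have [q q0 Qq] : exists2 q, 0 <= q & forall v, `|M (omega xi) v| <= q * `|v|.
    by exists (CM * `|omega xi|); rewrite ?mulr_ge0.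
  split=> [[Vu uE]|[r ru]].
    exact: (galerkin_saddle ipl ipC ip_norm br bl Cb0 bB beta_gt0 b_inf_sup
      K1 (Mr _) Qq lf F0 fF Vu uE).
  exact: (saddle_galerkin K2 ru).
have solv xi (g : V -> R) (G : R) : linear g -> 0 <= G ->
    (forall v, `|g v| <= G * `|v|) ->
    exists r u, saddle b Vh (M (varpi xi)) g r u.
  move=> lg G0 gG; have [K1 K2] := PK xi.
  apply: (saddle_exists ipl ipC ip_norm br bl Cb0 bB beta_gt0 b_inf_sup Vh_fin
    (alpha_h_gt0 xi) (varpi_coercive xi) K1 K2 (Mr _)
    (q := CM * `|omega xi|) _ lg G0 gG).
  by move=> v; exact: MB.
(* Solvability of the mixed problem ensures that [S f xi] is a true solution and not the default
   0. *)
have galS xi (f : {linear V -> R}) : continuous f ->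
    galerkin b Vh (M (omega xi)) f (S f xi).
  move=> cf; apply: (xgetPex 0).
  have [lf [F F0 fF]] := lcb f cf.
  have [r [u ru]] := solv xi f F lf F0 fF.
  by exists u; apply/galP => //; exists r.
(* Used twice: for fixed [xi] with its own [alpha_h xi] and [|varpi xi|], and with the uniform
   constants for all [xi]. *)
have stab (alpha p : R) : 0 < alpha -> 0 <= p -> exists2 K : R, 0 <= K &
    forall xi, alpha <= alpha_h xi -> `|varpi xi| <= p ->
    forall g r u G, 0 <= G -> saddle b Vh (M (varpi xi)) g r u ->
    (forall v, `|g v| <= G * `|v|) -> `|r| <= K * G /\ `|u| <= K * G.
  move=> alpha0 p0.
  have [|K K0 KP] := saddle_stable Cb0 bB beta_gt0 b_inf_sup Vh alpha0
    (_ : 0 <= CM * p); first exact: mulr_ge0.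
  exists K => // xi alphaxi varpip; apply: KP => v.
    move=> /(varpi_coercive xi); apply: le_trans.
    by rewrite ler_wpM2r ?sqr_ge0.
  by rewrite (le_trans (MB _ _))// ler_wpM2r// ler_wpM2l.
split=> [xi|alpha varpi_oo alpha0 varpi_oo0 alphaP varpiP f cf].
  have [K K0 /(_ xi (lexx _) (lexx _)) KP] :=
    stab _ _ (alpha_h_gt0 xi) (normr_ge0 (varpi xi)).
  have mstab (f g : {linear V -> R}) z z' (G : R) :
      mixed b Vh (M (varpi xi)) f z -> mixed b Vh (M (varpi xi)) g z' ->
      0 <= G -> (forall v, `|g v - f v| <= G * `|v|) ->
      `|z'.1 - z.1| <= K * G /\ `|z'.2 - z.2| <= K * G.
    move=> fz gz' G0 fgG; apply: KP G0 (saddle_sub br bl Vh_fin gz' fz) _ => v.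
    rewrite subrr [b 0 _](linear_fun0 (bl _)) addr0; exact: fgG.
  have mex (f : {linear V -> R}) : continuous f ->
      exists z, mixed b Vh (M (varpi xi)) f z.
    move=> /lcb[lf [F F0 fF]]; have [r [u ru]] := solv xi f F lf F0 fF.
    by exists (r, u).
  split; last by move=> f u cf; exact: galP.
    apply: (well_posed_stable K0) => [f cf|f g u u' G [cf fu] [cg gu'] G0 fgG].
      by exists (S f xi); exact: galS.
    have [r ru] := (galP _ _ _ cf).1 fu; have [r' ru'] := (galP _ _ _ cg).1 gu'.
    by have [] := mstab _ _ _ _ _ ru ru' G0 fgG.
  (* The norm of a pair is the maximum, so the same [K] serves. *)
  apply: (well_posed_stable K0) => [//|f g z z' G [cf fz] [cg gz'] G0 fgG].
  by have [h1 h2] := mstab _ _ _ _ _ fz gz' G0 fgG; rewrite prod_normE ge_max h1 h2.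
have [lf [F F0 fF]] := lcb f cf.
have [K K0 KP] := stab _ _ alpha0 (ltW varpi_oo0).
have /choice[rho rhoS] xi : exists r, saddle b Vh (M (varpi xi)) f r (S f xi).
  exact: ((galP _ _ _ cf).1 (galS xi f cf)).
have stable xi g r u G G0 s gG :=
  KP xi (alphaP xi) (varpiP xi) g r u G G0 s gG.
have c0 : 0 <= Cb * CM by exact: mulr_ge0.
have bMB w v r : `|b (M w v) r| <= Cb * CM * `|w| * `|v| * `|r|.
  rewrite (le_trans (bB _ _))// ler_wpM2r//.
  by rewrite -!mulrA ler_wpM2l// mulrA.
split.
  exists (K * F) => xi.
  by have [] := stable _ _ _ _ _ F0 (rhoS xi) fF.
move=> dvarpi.
have SG := saddle_gateaux br bl Vh_fin Ml Mr c0 bMB K0 stable solv F0 fF rhoS dvarpi.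
have SV := saddle_derive_subspace br bl Vh_fin Ml Mr c0 bMB K0 stable solv F0 fF
  rhoS dvarpi.
split=> // bd ld; split.
  exact: (saddle_bounded_derivative br bl Vh_fin Ml Mr c0 bMB K0 stable solv F0 fF
    rhoS dvarpi bd).
exact: (saddle_lipschitz_derivative br bl Vh_fin Ml Mr c0 bMB K0 stable solv F0 fF
  rhoS dvarpi bd ld).
Qed.
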